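(* Given any $G \in \mathcal{T}$ there is some $n \geq 3$ such that there is a commation $G \nearrow \nwarrow \nearrow \mathrm{Aut}(T_n)$.
   Context: All groups are locally compact (l.c.) Hausdorff groups. A homomorphism of l.c. groups is copci if it is continuous, proper (preimages of compact sets are compact) and has closed cocompact image. $G\nearrow\nwarrow\nearrow H$ denotes the existence of l.c. groups $G_1,G_2$ and copci homomorphisms $G\to G_1$, $G_2\to G_1$, $G_2\to H$. An isometric action of a l.c. group on a proper metric space is geometric if it is continuous, proper and cocompact. A l.c. group is non-elementary if it does not act continuously and properly by isometries on the real line. $\mathcal{T}$ is the class of all non-elementary l.c. groups admitting a geometric action on a locally finite simplicial tree. $T_n$ is the $n$-regular tree and $\mathrm{Aut}(T_n)$ its automorphism group with the topology of pointwise convergence. *)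

(* Defs.v *)
From HB Require Import structures.
From mathcomp Require Import all_boot all_order all_algebra.
From mathcomp Require Import all_classical all_reals.
From mathcomp Require Import topology_theory.topology function_spaces.
From mathcomp Require Import subtype_topology discrete_topology.
From mathcomp Require Import Rstruct Rstruct_topology.
From Stdlib Require Import Rdefinitions.

Set Implicit Arguments.
Unset Strict Implicit.
Unset Printing Implicit Defensive.
Import Order.TTheory GRing.Theory Num.Theory.
Local Open Scope classical_set_scope.

Record tgroup := TGroup {
  tg_car :> topologicalType;
  tg_mul : tg_car -> tg_car -> tg_car }.

Definition is_lcgroup (G : tgroup) : Prop :=
  hausdorff_space G /\ locally_compact [set: G] /\
  exists (one : G) (inv : G -> G),
    (forall x y z : G, tg_mul x (tg_mul y z) = tg_mul (tg_mul x y) z) /\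
    (forall x : G, tg_mul one x = x) /\
    (forall x : G, tg_mul (inv x) x = one) /\
    continuous (fun p : G * G => tg_mul p.1 p.2) /\
    continuous inv.

Definition group_hom (G H : tgroup) (f : G -> H) : Prop :=
  forall x y : G, f (tg_mul x y) = tg_mul (f x) (f y).

Definition copci (G H : tgroup) (f : G -> H) : Prop :=
  group_hom f /\ continuous f /\
  (forall K : set H, compact K -> compact (f @^-1` K)) /\
  closed (range f) /\
  (exists K : set H, compact K /\
     forall h : H, exists g k, K k /\ h = tg_mul (f g) k).

Definition commable (G H : tgroup) : Prop :=
  exists (G1 G2 : tgroup), is_lcgroup G1 /\ is_lcgroup G2 /\
  (exists f : G -> G1, copci f) /\
  (exists f : G2 -> G1, copci f) /\
  (exists f : G2 -> H, copci f).

Fixpoint walk {V : Type} (E : V -> V -> Prop) (u : V) (s : seq V) (v : V)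
  : Prop :=
  match s with
  | [::] => u = v
  | x :: s' => E u x /\ walk E x s' v
  end.

Fixpoint nonbacktracking {V : Type} (s : seq V) : Prop :=
  match s with
  | x :: ((y :: z :: _) as s') => x <> z /\ nonbacktracking s'
  | _ => True
  end.

Definition is_tree {V : Type} (E : V -> V -> Prop) : Prop :=
  (forall x y, E x y -> E y x) /\
  (forall x, ~ E x x) /\
  (forall u v, exists s, walk E u s v) /\
  (forall u s, walk E u s u -> nonbacktracking (u :: s) -> s = [::]).

Definition locally_finite_graph {V : Type} (E : V -> V -> Prop) : Prop :=
  forall v, finite_set [set w | E v w].

Definition tree_automorphism {V : Type} (E : V -> V -> Prop) (f : V -> V)
  : Prop := bijective f /\ forall x y, E (f x) (f y) <-> E x y.

(* Geometric (continuous, proper, cocompact) action of G by automorphisms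
   on the tree, i.e. by isometries of the vertex set with its path metric
   (in which compact = finite). *)
Definition geometric_tree_action (G : tgroup) (V : pointedType)
  (E : V -> V -> Prop) (a : G -> V -> V) : Prop :=
  (forall g, tree_automorphism E (a g)) /\
  (forall g h, a (tg_mul g h) = a g \o a h) /\
  continuous (fun p : G * discrete_topology V => (a p.1 p.2 : discrete_topology V)) /\
  (forall K : set V, finite_set K ->
     compact [set g : G | exists k, K k /\ K (a g k)]) /\
  (exists K : set V, finite_set K /\
     forall v, exists g k, K k /\ a g k = v).

Definition non_elementary (G : tgroup) : Prop :=
  ~ exists b : G -> R -> R,
      (forall g x y, @Num.norm _ R (b g x - b g y)%R = @Num.norm _ R (x - y)%R) /\
      (forall g h, b (tg_mul g h) = b g \o b h) /\
      continuous (fun p : G * R => b p.1 p.2) /\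
      (forall K : set R, compact K ->
         compact [set g : G | exists k, K k /\ K (b g k)]).

Definition in_class_T (G : tgroup) : Prop :=
  is_lcgroup G /\ non_elementary G /\
  exists (V : pointedType) (E : V -> V -> Prop) (a : G -> V -> V),
    is_tree E /\ locally_finite_graph E /\ geometric_tree_action E a.

(* The n-regular tree T_n: reduced words over 'I_n (no letter repeated *)
(* twice in a row), adjacent when one extends the other by one letter. *)
Definition Tn_vert (n : nat) := {s : seq 'I_n | sorted (fun a b => a != b) s}.
HB.instance Definition _ n := [Choice of Tn_vert n by <:].
HB.instance Definition _ n :=
  isPointed.Build (Tn_vert n) (exist _ [::] erefl).

Definition Tn_adj (n : nat) (x y : Tn_vert n) : Prop :=
  (exists a, val y = rcons (val x) a) \/ (exists a, val x = rcons (val y) a).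

Definition AutTn_set (n : nat)
  : set {ptws Tn_vert n -> discrete_topology (Tn_vert n)} :=
  [set f | tree_automorphism (@Tn_adj n) f].
Arguments AutTn_set : clear implicits.

Lemma AutTn_comp (n : nat) (f g : AutTn_set n) :
  (val f \o val g : {ptws Tn_vert n -> discrete_topology (Tn_vert n)})
    \in AutTn_set n.
Proof.
apply/mem_set; rewrite /AutTn_set /tree_automorphism /=.
have := set_valP f; rewrite /AutTn_set /tree_automorphism /= => -[[fi fK Kf] fE].
have := set_valP g; rewrite /AutTn_set /tree_automorphism /= => -[[gi gK Kg] gE].
split.
  by exists (gi \o fi) => x /=; rewrite ?fK ?gK ?Kf ?Kg.
by move=> x y /=; rewrite fE gE.
Qed.

Definition AutTn (n : nat) : tgroup :=
  @TGroup (AutTn_set n : Type)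
    (fun f g : AutTn_set n => SigSub (AutTn_comp f g)).

(* Main.v *)
(* Among all geometric actions of G on locally finite trees choose one, on a
   tree T, with as few vertex orbits as possible, and colour vertices by their
   orbits. If some vertex of colour i had exactly one neighbour of colour j <> i,
   then merging every vertex of colour i into that neighbour would give a tree
   with fewer orbits; so the number N i j of j-coloured neighbours of an
   i-coloured vertex is never 1 when i <> j.

   Let tau be a spanning tree of the (connected) graph of adjacent colours. Since
   N >= 2 along tau, lowering N i j by one on the edges of tau leaves numbers M i j
   with M i j > 0 iff M j i > 0. With n the sum of the M i j, the edges of T_n can
   be labelled so that every vertex has exactly M i j outgoing edges labelled
   (i, j), reversed edges having reversed labels. Blowing up each vertex of T_n
   to a copy of tau, and attaching an edge labelled (i, j) at the vertices of
   colours i and j, gives a tree with the same neighbour counts N as T, hence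
   isomorphic to T. The group of label preserving automorphisms of T_n is vertex
   transitive, so it acts geometrically both on T_n and on the blow-up T; this
   gives G -> Aut T <- G_2 -> Aut T_n. If n <= 2, then T is finite or a line and
   G is elementary. *)
From HB Require Import structures.
Require Import Defs.
From mathcomp Require Import all_boot all_order all_algebra.
From mathcomp Require Import all_classical all_reals.
From mathcomp Require Import topology_theory.topology function_spaces.
From mathcomp Require Import normedtype_theory.normedtype.
From mathcomp Require Import Rstruct_topology.
From mathcomp Require Import perm zify ring.

Set Implicit Arguments.
Unset Strict Implicit.
Unset Printing Implicit Defensive.
Import Order.TTheory GRing.Theory Num.Theory numFieldNormedType.Exports.

Local Open Scope classical_set_scope.

(** * Rooted trees *)

(** Connectedness and acyclicity are both encoded by every vertex reaching [r] under [par], so maps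
    can be built by recursion from the root. The equation [par r = r] is a default value and creates
    no loop. *)
Definition rooted (V : Type) (E : V -> V -> Prop) (r : V) (par : V -> V) :=
  par r = r /\ (forall v, exists k, iter k par v = r) /\
  (forall v w, E v w <-> (v <> r /\ w = par v) \/ (w <> r /\ v = par w)).

Lemma rooted_depth (V : eqType) E (r : V) par : rooted E r par ->
  exists d : V -> nat, d r = 0%N /\
    (forall v, v <> r -> d v = (d (par v)).+1).
Proof.
move=> [pr [reach _]].
have /choice[d dP] : forall v, exists m, iter m par v = r /\
    forall k, iter k par v = r -> (m <= k)%N.
  move=> v; have ex : exists k, iter k par v == r.
    by have [k kr] := reach v; exists k; apply/eqP.
  exists (ex_minn ex); case: ex_minnP => m /eqP mr mmin; split=> // k /eqP.
  exact: mmin.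
exists d; split=> [|v vr].
  by apply/eqP; rewrite -leqn0; apply: (dP r).2.
have [dv dmin] := dP v; have [dpv dpmin] := dP (par v).
apply/eqP; rewrite eqn_leq dmin ?iterSr //=.
case: (d v) dv => [/vr//|m] /=; rewrite -iterS iterSr => /dpmin.
by rewrite ltnS.
Qed.

Lemma rooted_ind (V : eqType) E (r : V) par (P : V -> Prop) :
  rooted E r par -> P r -> (forall v, v <> r -> P (par v) -> P v) ->
  forall v, P v.
Proof.
move=> [_ [reach _]] Pr Pstep v; have [k] := reach v.
elim: k v => [v /= -> //|k IH v].
by rewrite iterSr => /IH Pp; have [->//|/eqP vr] := eqVneq v r; apply: Pstep.
Qed.

Lemma rooted_sym (V : Type) E (r : V) par : rooted E r par ->
  forall v w, E v w -> E w v.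
Proof. by move=> [_ [_ RE]] v w /RE vw; apply/RE; tauto. Qed.

Lemma rooted_par (V : Type) E (r : V) par : rooted E r par ->
  forall v, v <> r -> E v (par v).
Proof. by move=> [_ [_ RE]] v vr; apply/RE; left. Qed.

Lemma par_neq (V : eqType) E (r : V) par : rooted E r par ->
  forall v, v <> r -> par v <> v.
Proof.
move=> R v vr pv; have [d [_ dS]] := rooted_depth R.
by have := dS _ vr; rewrite pv; lia.
Qed.

Lemma par2_neq (V : eqType) E (r : V) par : rooted E r par ->
  forall v, v <> r -> par (par v) <> v.
Proof.
move=> R v vr pv; have [d [d0 dS]] := rooted_depth R.
have := dS _ vr; have [pr|/eqP/dS] := eqVneq (par v) r; last by rewrite pv; lia.
by move: vr; rewrite -pv pr R.1.
Qed.

Lemma rooted_irrefl (V : eqType) E (r : V) par : rooted E r par ->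
  forall v, ~ E v v.
Proof. by move=> R v /R.2.2[] [vr /esym]; apply: (par_neq R). Qed.

(** Moving the root across one edge reverses that edge only: [r] gets the parent [r'], the other
    parents stay. *)
Lemma reroot_child (V : eqType) E (r : V) par r' : rooted E r par ->
  r' <> r -> par r' = r ->
  rooted E r' (fun v => if (v == r') || (v == r) then r' else par v).
Proof.
move=> R r'r pr'; split; first by rewrite eqxx.
split=> [|v w].
  apply: (rooted_ind R); first by exists 1%N; rewrite /= eqxx orbT.
  move=> v vr [k kr']; have [->|vr'] := eqVneq v r'; first by exists 0%N.
  by exists k.+1; rewrite iterSr /= (negPf vr') /= (introF eqP vr).
have pr := R.1; rewrite R.2.2.
by case: (eqVneq v r') => /= [->|/eqP vr']; case: (eqVneq v r) => /= [?|/eqP vr];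
  case: (eqVneq w r') => /= [->|/eqP wr'];
  case: (eqVneq w r) => /= [?|/eqP wr];
  subst; intuition congruence.
Qed.

Lemma reroot (V : eqType) E (r : V) par r' : rooted E r par ->
  exists par', rooted E r' par'.
Proof.
move=> R; move: r'; apply: (rooted_ind R); first by exists par.
move=> v vr [par' R']; have Evp := rooted_par R vr.
have vp : v <> par v by apply/nesym/(par_neq R).
have := reroot_child R' vp; move/R'.2.2: Evp => [[_ <-]|[]//].
by move=> /(_ erefl) R''; eexists; exact: R''.
Qed.

(** The isomorphism is extended from each vertex to its children, starting with [r] sent to [r'].
    The relation [M] is the invariant carried along: a matched pair must admit a bijection [b]
    between children that yields matched pairs again. *)
Lemma rooted_iso (V V' : eqType) E E' (r : V) (r' : V') par par'
    (M : V -> V' -> Prop) : rooted E r par -> rooted E' r' par' -> M r r' ->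
  (forall v v', M v v' -> exists b : V -> V',
     (forall w, w <> r -> par w = v ->
        [/\ b w <> r', par' (b w) = v' & M w (b w)]) /\
     (forall w1 w2, w1 <> r -> par w1 = v -> w2 <> r -> par w2 = v ->
        b w1 = b w2 -> w1 = w2) /\
     (forall w', w' <> r' -> par' w' = v' ->
        exists w, [/\ w <> r, par w = v & b w = w'])) ->
  exists f : V -> V', [/\ bijective f, f r = r', forall v, M v (f v),
    forall v, f (par v) = par' (f v) & forall v w, E v w <-> E' (f v) (f w)].
Proof.
move=> R R' Mr ext; have [d [d0 dS]] := rooted_depth R.
have /choice[b bP] : forall p : V * V', exists b : V -> V', M p.1 p.2 ->
     (forall w, w <> r -> par w = p.1 ->
        [/\ b w <> r', par' (b w) = p.2 & M w (b w)]) /\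
     (forall w1 w2, w1 <> r -> par w1 = p.1 -> w2 <> r -> par w2 = p.1 ->
        b w1 = b w2 -> w1 = w2) /\
     (forall w', w' <> r' -> par' w' = p.2 ->
        exists w, [/\ w <> r, par w = p.1 & b w = w']).
  move=> [v v']; have [/ext[b bP]|nM] := pselect (M v v'); first by exists b.
  by exists (fun=> r').
(* The first argument is the depth of the vertex and serves as fuel for the recursion along
   [par]. *)
pose F := fix F k v := if k is k'.+1 then b (par v, F k' (par v)) v else r'.
pose f v := F (d v) v.
have fr : f r = r' by rewrite /f d0.
have fS v : v <> r -> f v = b (par v, f (par v)) v by move=> /dS; rewrite /f => ->.
have Mf : forall v, M v (f v).
  apply: (rooted_ind R); first by rewrite fr.
  move=> v vr /(bP (_, _))[+ _] => /(_ v vr erefl)[_ _].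
  by rewrite -fS.
have fchild v : v <> r -> f v <> r' /\ par' (f v) = f (par v).
  move=> vr; have [+ _] := bP (_, _) (Mf (par v)).
  by move=> /(_ v vr erefl)[]; rewrite -fS.
have fpar v : f (par v) = par' (f v).
  have [->|/eqP/fchild[_ ->]//] := eqVneq v r.
  by rewrite R.1 fr R'.1.
have finj : injective f.
  move=> v; move: v; apply: (rooted_ind R) => [w|v vr IH w].
    rewrite fr => /esym fw; apply/eqP; apply: contraPT fw => /eqP/nesym wr.
    by have [] := fchild _ wr.
  move=> fvw; have wr : w <> r.
    by move=> wr; have [] := fchild _ vr; rewrite fvw wr fr.
  have pvw : par v = par w by apply: IH; rewrite !fpar fvw.
  have [_ [binj _]] := bP (_, _) (Mf (par v)).
  by apply: binj => //=; rewrite -fS // fvw fS // pvw.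
have fsurj : forall w, exists v, f v = w.
  apply: (rooted_ind R'); first by exists r.
  move=> w wr' [v fv]; have [_ [_ /(_ w wr')]] := bP (_, _) (Mf v).
  by rewrite /= fv => /(_ erefl)[u [ur pu <-]]; exists u; rewrite fS // pu fv.
have fnr v : f v <> r' <-> v <> r.
  by split=> [+ vr|/fchild[]//]; rewrite vr fr.
exists f; split=> //.
  have [g gK] := choice fsurj.
  by exists g => // v; apply: finj; rewrite gK.
move=> v w; rewrite R.2.2 R'.2.2 !fnr -!fpar.
by split=> -[[? e]|[? e]]; [left|right|left|right]; split=> //;
  rewrite ?e //; apply: finj.
Qed.

(** * Reduced walks, and rooting a tree given by walks *)

Fixpoint heads_differ {V : Type} (s t : seq V) : Prop :=
  match s, t with x :: _, y :: _ => x <> y | _, _ => True end.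

Lemma nonbacktracking_cons (V : Type) (v : V) s : nonbacktracking (v :: s) <->
  match s with y :: z :: _ => v <> z /\ nonbacktracking s | _ => True end.
Proof. by case: s => [|y [|z s]]. Qed.

Lemma nonbacktracking_behead (V : Type) (v : V) s :
  nonbacktracking (v :: s) -> nonbacktracking s.
Proof. by case: s => [|y [|z s]] // []. Qed.

Lemma nonbacktracking_catrev (V : Type) (v : V) s t :
  nonbacktracking (v :: s) -> nonbacktracking (v :: t) -> heads_differ s t ->
  nonbacktracking (catrev s (v :: t)).
Proof.
elim: s v t => [//|x s IH] v t ns nt hd /=; apply: IH.
- exact: nonbacktracking_behead ns.
- by case: t nt hd => [//|y t] nt /= hd; split.
- by case: s ns {hd} => [//|y s] [/nesym].
Qed.

Lemma walk_catrev (V : Type) (E : V -> V -> Prop) u v w s t :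
  (forall x y, E x y -> E y x) -> walk E v s u -> walk E v t w ->
  exists q, catrev s (v :: t) = u :: q /\ walk E u q w /\
    (size q = size s + size t)%N.
Proof.
move=> Esym; elim: s v t => [|x s IH] v t /=.
  by move=> <- wt; exists t; rewrite add0n.
move=> [vx ws] wt; have [|q [-> [wq sq]]] := IH x (v :: t) ws.
  by split=> //; apply: Esym.
by exists q; rewrite sq /= addnS addSn.
Qed.

(** Two reduced walks that do not share their first step would join at [v] into a nonempty reduced
    closed walk at [r], against acyclicity; a shared first step is removed by induction. *)
Lemma reduced_walk_uniq (V : Type) (E : V -> V -> Prop) v r s t : is_tree E ->
  walk E v s r -> nonbacktracking (v :: s) ->
  walk E v t r -> nonbacktracking (v :: t) -> s = t.
Proof.
move=> [Esym [_ [_ acyc]]]; elim: s v t => [|x s IH] v t.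
  by move=> /= -> _ wt nt; rewrite (acyc _ _ wt nt).
move=> ws ns wt nt; have [xt|xt] := pselect (exists t', t = x :: t').
  case: xt => t' xt; move: wt nt; rewrite xt => wt nt.
  congr cons; apply: (IH x) => //; first by case: ws.
  - exact: nonbacktracking_behead ns.
  - by case: wt.
  - exact: nonbacktracking_behead nt.
have [q [eq [wq]]] := walk_catrev Esym ws wt.
have := nonbacktracking_catrev ns nt; rewrite eq => /(_ _)/(acyc _ _ wq) -> //.
by case: t xt {wt nt eq} => // y t xt /= xy; apply: xt; exists t; rewrite xy.
Qed.

Lemma reduced_walk_ex (V : Type) (E : V -> V -> Prop) v r s : is_tree E ->
  walk E v s r -> exists t, walk E v t r /\ nonbacktracking (v :: t).
Proof.
move=> tE; elim: s v => [v /= ->|x s IH v [vx /IH[t [wt nt]]]]; first by exists [::].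
have [[t' tv]|tv] := pselect (exists t', t = v :: t').
  exists t'; move: wt nt; rewrite tv => -[_ wt] nt; split=> //.
  exact: nonbacktracking_behead nt.
exists (x :: t); split=> //; apply/nonbacktracking_cons.
case: t {wt} nt tv => // y t nt tv; split=> // vy.
by apply: tv; exists t; rewrite vy.
Qed.

(** The parent of [v] is the first vertex on the unique reduced walk from [v] to [r]; the walk from
    [r] is empty, so the default of [head] fixes the root. *)
Lemma tree_rooted (V : eqType) (E : V -> V -> Prop) r : is_tree E ->
  exists par, rooted E r par.
Proof.
move=> tE; have [Esym [Eirr [conn _]]] := tE.
have /choice[s sP] : forall v, exists s, walk E v s r /\ nonbacktracking (v :: s).
  by move=> v; have [t /(reduced_walk_ex tE)] := conn v r.
have sE v t : walk E v t r -> nonbacktracking (v :: t) -> s v = t.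
  by have [ws ns] := sP v; apply: reduced_walk_uniq.
have sr : s r = [::] by apply: sE.
have sN v : v <> r -> exists x, s v = x :: s x /\ E v x.
  move=> vr; have [+ +] := sP v; case: (s v) => [//|x t] [vx wt] nt.
  by exists x; rewrite (sE x t) //; apply: nonbacktracking_behead nt.
exists (fun v => head v (s v)); split; first by rewrite sr.
split=> [v|v w].
  elim: {v}(size (s v)) {-2}v (erefl (size (s v))) => [|k IH] v.
    move=> sv; have [->|/eqP/sN[x [svE _]]] := eqVneq v r; first by exists 0%N.
    by move: sv; rewrite svE.
  have [->|/eqP/sN[x [svE _]]] := eqVneq v r; first by exists 0%N.
  rewrite svE /= => -[/IH[m mr]]; exists m.+1.
  by rewrite iterSr svE.
split=> [vw|[[/sN[x [-> vx]] ->]//|[/sN[x [-> vx]] ->]]]; last exact: Esym.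
(* Either the reduced walk of [v] starts with [w], and [w] is the parent, or prefixing [v] to it
   gives a reduced walk from [w], and [v] is the parent. *)
have [|vw'] := pselect (exists t, s v = w :: t).
  move=> [t sv]; left; rewrite sv; split=> // vr.
  by move: sv; rewrite vr sr.
right; have [ws ns] := sP v.
rewrite (sE w (v :: s v)) /=; last first.
- case: (s v) vw' ns => // y t vw' ns; split=> // wy.
  by apply: vw'; exists t; rewrite wy.
- by split=> //; apply: Esym.
split=> // wr; move: vw'; case: (eqVneq v r) => [vr|/eqP vr].
  by move: vw; rewrite wr vr => /Eirr.
move=> vw'; move: (sE v [:: w]); rewrite /= => /(_ (conj vw wr) I) sv.
by apply: vw'; exists [::].
Qed.

(** * Groups of permutations with the pointwise topology *)

Lemma ultra_finite_range (T : Type) (V : eqType) (F : set_system T) (f : T -> V)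
    (l : seq V) : UltraFilter F -> F [set t | f t \in l] ->
  exists x, F [set t | f t = x].
Proof.
move=> FU; elim: l => [F0|x l IH Fl].
  by have [t] := filter_ex F0.
have [Fx|Fx] := in_ultra_setVsetC [set t | f t = x] FU; first by exists x.
apply: IH; apply: filterS2 Fl Fx => t /=; rewrite inE => /orP[/eqP//|//].
Qed.

Lemma near_seq (T : Type) (V : eqType) (F : set_system T) (P : V -> T -> Prop)
    (l : seq V) : Filter F -> (forall v, F (P v)) ->
  F [set t | forall v, v \in l -> P v t].
Proof.
move=> FF FP; elim: l => [|x l IH]; first by apply: filterE.
apply: filterS2 (FP x) IH => t Px Pl v; rewrite inE => /orP[/eqP->//|].
exact: Pl.
Qed.

HB.instance Definition _ (V : pointedType) := Pointed.on (discrete_topology V).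

Lemma compact_discrete_finite (V : pointedType) (A : set V) :
  compact (A : set (discrete_topology V)) -> finite_set A.
Proof.
rewrite compact_cover.
move=> /(_ V setT (fun v => [set v])) [].
- by move=> v _; apply: discrete_open.
- by move=> v _; exists v.
move=> D _ AD; apply: (sub_finite_set _ (finite_fset D)).
by move=> v /AD[w /= Dw ->].
Qed.

Lemma finite_bigcup_compact (X : topologicalType) (T : choiceType) (A : set T)
    (B : T -> set X) : finite_set A -> (forall t, compact (B t)) ->
  compact (\bigcup_(t in A) B t).
Proof.
move=> /finite_seqP[l ->] Bc; rewrite bigcup_seq.
by apply: bigsetU_compact.
Qed.

(** Geometricity read off single vertices, without edges, so that it passes to quotients and
    blow-ups. Vertices being discrete, continuity becomes local constancy of orbit maps, and
    properness becomes compactness of the sets carrying one vertex to another. *)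
Definition geometric (G : tgroup) (V : pointedType) (a : G -> V -> V) : Prop :=
  (forall g h, a (tg_mul g h) = a g \o a h) /\
  (forall g v, \forall g' \near g, a g' v = a g v) /\
  (forall v w, compact [set g | a g v = w]) /\
  (exists K : set V, finite_set K /\ forall v, exists g k, K k /\ a g k = v).

Lemma near_const_closed (X : topologicalType) (T : Type) (f : X -> T) (t : T) :
  (forall x, \forall y \near x, f y = f x) -> closed [set x | f x = t].
Proof. by move=> fE x /(_ _ (fE x))[y [/= <- ->]]. Qed.

Lemma geometric_tree_actionW (G : tgroup) (V : pointedType)
    (E : V -> V -> Prop) (a : G -> V -> V) :
  geometric_tree_action E a -> geometric a.
Proof.
move=> [_ [aM [aC [aP aCC]]]]; split=> //.
have aN g v : \forall g' \near g, a g' v = a g v.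
  have [[A B] [/= Ag Bv] AB] :=
    @aC (g, v) _ (discrete_set1 (a g v : discrete_topology V)).
  apply: filterS Ag => g' Ag'; apply: (AB (g', v)); split=> //=.
  exact: (nbhs_singleton Bv).
split=> //; split=> // v w.
have fin : finite_set [set v; w] by rewrite finite_setU; split.
apply: (subclosed_compact _ (aP _ fin)).
  by apply: near_const_closed => g; apply: aN.
by move=> g /= gv; exists v; split; [left|right].
Qed.

(** As the fibres of the equivariant map [p] are finite, the elements carrying [w] to [w'] form a
    finite union of compact sets of elements carrying one vertex to another upstairs. *)
Lemma geometric_pushforward (G : tgroup) (V W : pointedType) (a : G -> V -> V)
    (b : G -> W -> W) (p : V -> W) :
  geometric a -> (forall g v, b g (p v) = p (a g v)) ->
  (forall w, exists v, p v = w) -> (forall w, finite_set [set v | p v = w]) ->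
  geometric b.
Proof.
move=> [aM [aN [aP [K [Kfin KP]]]]] ab psurj pfin; split.
  by move=> g h; apply/funext => w; have [v <-] := psurj w; rewrite /= !ab aM.
split.
  move=> g w; have [v <-] := psurj w; rewrite ab.
  by apply: filterS (aN g v) => g' /= ag; rewrite ab ag.
split.
  move=> w w'; have [v pv] := psurj w.
  have := finite_bigcup_compact (pfin w') (aP v); congr compact.
  rewrite predeqE => g /=; split=> [[u <-]|]; rewrite -pv ab /=.
    by move=> ->.
  by exists (a g v).
exists (p @` K); split; first exact: finite_image.
move=> w; have [v <-] := psurj w; have [g [k [Kk <-]]] := KP v.
by exists g, (p k); split=> //; exists k.
Qed.

Section PermutationGroup.
Variable V : pointedType.
Let fspace := {ptws V -> discrete_topology V}.
Variable S : set fspace.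
Hypothesis Scomp : forall f g : S, (val f \o val g : fspace) \in S.

Definition perm_group : tgroup :=
  @TGroup (S : Type) (fun f g : S => SigSub (Scomp f g)).

Let ap (h : perm_group) (v : V) : V := (val (h : S) : fspace) v.

Lemma perm_group_cvg (F : set_system perm_group) (h : perm_group) :
  Filter F -> (forall v, F [set h' | ap h' v = ap h v]) -> F --> h.
Proof.
move=> FF Fv U [_ [[W oW <-] Wh] WU]; apply: (filterS WU).
have : val @ F --> (val (h : S) : fspace).
  apply/cvg_sup => v U' [_ [[B oB <-] Bh] BU']; apply: (filterS BU').
  change (F [set h' | B (ap h' v)]).
  by apply: filterS (Fv v) => h' /= ->; exact: Bh.
by apply; apply: open_nbhs_nbhs; split.
Qed.

Lemma perm_group_near (h : perm_group) v :
  \forall h' \near h, ap h' v = ap h v.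
Proof.
have := @proj_continuous V (fun=> discrete_topology V) v (val (h : S)) _
  (discrete_set1 (ap h v : discrete_topology V)).
exact: (@initial_continuous S fspace set_val h).
Qed.

Lemma perm_groupP (h h' : perm_group) : (forall v, ap h v = ap h' v) -> h = h'.
Proof. by move=> e; apply: val_inj; apply/funext. Qed.

Lemma perm_group_continuous (X : topologicalType) (f : X -> perm_group) :
  (forall v x, \forall y \near x, ap (f y) v = ap (f x) v) -> continuous f.
Proof. by move=> fv x; apply: perm_group_cvg => v; apply: fv. Qed.

Lemma perm_group_hausdorff : hausdorff_space perm_group.
Proof.
move=> h h' hh; apply: perm_groupP => v.
have [g [/= <- <-]//] := hh _ _ (perm_group_near h v) (perm_group_near h' v).
Qed.

(** Preserving relations makes [S] a group of permutations, stable under pointwise limits that are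
    bijective. The finiteness of the places where [u] can go once [v] goes to [w] is what makes
    point stabilisers compact. *)
Definition closed_permutations := exists (I : Type) (R : I -> V -> V -> Prop),
  (forall f, S f <-> bijective f /\ forall i x y, R i (f x) (f y) <-> R i x y) /\
  (forall v w u, finite_set [set x | exists2 f, S f & f v = w /\ f u = x]).

Hypothesis SP : closed_permutations.

Lemma perm_group_inv (h : perm_group) : exists g : perm_group,
  cancel (ap h) (ap g) /\ cancel (ap g) (ap h).
Proof.
have [I [R [SE _]]] := SP; have [[g hK gK] hR] := (SE _).1 (set_valP h).
have Sg : S g.
  by apply/SE; split=> [|i x y]; [exists (ap h)|rewrite -hR !gK].
by exists (SigSub (mem_set Sg)).
Qed.

Lemma perm_group_one : exists e : perm_group, forall v, ap e v = v.
Proof.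
have [I [R [SE _]]] := SP.
have Sg : S id by apply/SE; split=> //; exists id.
by exists (SigSub (mem_set Sg)).
Qed.

(** An ultrafilter on this set has a pointwise limit [f], since each vertex has finitely many
    possible images. On any finite set [f] agrees with an element of the group, which gives
    injectivity and the relations. *)
Lemma perm_group_stab_compact v w : compact [set h : perm_group | ap h v = w].
Proof.
have [I [R [SE Sfin]]] := SP; rewrite compact_ultra => F FU Fvw.
have /choice[f fP] : forall u, exists x, F [set h | ap h u = x].
  move=> u; have [l lE] := (finite_seqP _).1 (Sfin v w u).
  apply: (@ultra_finite_range _ _ _ _ l); apply: filterS Fvw => h hv.
  have : [set` l] (ap h u); last by [].
  by rewrite -lE; exists (ap h) => //; apply: set_valP.
have Fl (l : seq V) : exists h : perm_group, forall u, u \in l -> ap h u = f u.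
  exact: filter_ex (near_seq l _ fP).
have fvw : f v = w by have [h [/= <- <-]] := filter_ex (filterI Fvw (fP v)).
have finj : injective f.
  move=> x y fxy; have [h hE] := Fl [:: x; y].
  have [g [hg _]] := perm_group_inv h; apply: (can_inj hg).
  by rewrite !hE ?inE ?eqxx ?orbT.
(* The list [l] contains all places where an inverse, which sends [w] to [v], can move [u]. If [h]
   agrees with [f] on [v] and on [l], the preimage of [u] under [h] lies in [l], where [f] and [h]
   coincide. *)
have fsurj u : exists x, f x = u.
  have [l lE] := (finite_seqP _).1 (Sfin w v u).
  have [h hE] := Fl (v :: l); have [g [hg gh]] := perm_group_inv h.
  exists (ap g u); rewrite -hE ?gh // inE; apply/orP; right.
  have : [set` l] (ap g u); last by [].
  rewrite -lE; exists (ap g); first exact: set_valP.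
  by split=> //; rewrite -fvw -hE ?hg // mem_head.
have Sf : S f.
  apply/SE; split=> [|i x y].
    by have [g gK] := choice fsurj; exists g => // x; apply: finj; rewrite gK.
  have [h hE] := Fl [:: x; y]; have [_ hR] := (SE _).1 (set_valP h).
  by rewrite -!hE ?inE ?eqxx ?orbT //; apply: hR.
exists (SigSub (mem_set Sf)); split=> //.
exact: perm_group_cvg.
Qed.

Lemma perm_group_stab_closed v w : closed [set h : perm_group | ap h v = w].
Proof.
by move=> h /(_ _ (perm_group_near h v))[h' [/= <- ->]].
Qed.

Lemma perm_group_lc : is_lcgroup perm_group.
Proof.
split; first exact: perm_group_hausdorff.
split.
  move=> h _; exists [set h' | ap h' point = ap h point].
    by apply: filterS (perm_group_near h point) => h' e _.
  split=> //; first exact: perm_group_stab_compact.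
  exact: perm_group_stab_closed.
have [e eP] := perm_group_one; have [inv invP] := choice perm_group_inv.
exists e, inv; split; first by move=> x y z; apply: perm_groupP.
split; first by move=> x; apply: perm_groupP => v; apply: eP.
split; first by move=> x; apply: perm_groupP => v; rewrite eP; apply: (invP x).1.
split.
  apply: perm_group_continuous => v [g h].
  exists ([set g' | ap g' (ap h v) = ap g (ap h v)],
          [set h' | ap h' v = ap h v]).
    by split; apply: perm_group_near.
  by move=> [g' h'] /= [gE hE]; rewrite -[RHS]gE -hE.
apply: perm_group_continuous => v h.
apply: filterS (perm_group_near h (ap (inv h) v)) => h' /= hE.
by apply: (can_inj (invP h').1); rewrite (invP h').2 hE (invP h).2.
Qed.

(** * Copci homomorphisms from geometric actions *)

Section Copci.
Variable G : tgroup.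
Hypothesis GP : is_lcgroup G.
Variable a : G -> V -> V.
Hypothesis aG : geometric a.
Hypothesis aS : forall g, S (a g).

Definition act_hom (g : G) : perm_group := SigSub (mem_set (aS g)).

Lemma act_hom_continuous : continuous act_hom.
Proof. by apply: perm_group_continuous => v g; apply: aG.2.1. Qed.

Lemma act_copci : copci act_hom.
Proof.
split; first by move=> g h; apply: perm_groupP => v; rewrite /ap /= aG.1.
split; first exact: act_hom_continuous.
split.
  (* Properness: [K] moves [point] to finitely many vertices only, so its preimage is a closed
     subset of a finite union of compact sets. *)
  move=> K Kc; have Kcl : closed K.
    by apply: compact_closed => //; apply: perm_group_hausdorff.
  have fin : finite_set [set v | exists2 h, K h & ap h point = v].
    apply: (@compact_discrete_finite V).
    apply: (@continuous_compact _ _ (fun h => ap h point : discrete_topology V)) => //.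
    apply: continuous_subspaceT => h U /nbhs_singleton Uh.
    by apply: filterS (perm_group_near h point) => h' /= ->.
  have := finite_bigcup_compact fin (aG.2.2.1 point).
  move=> /subclosed_compact; apply.
    by apply: preimage_closed => // g _; apply: act_hom_continuous.
  by move=> g Kg; exists (a g point) => //; exists (act_hom g).
split.
  (* Closed image: elements of the image near [h] agree with [h] at [point], hence come from one
     compact set, whose image is closed. *)
  move=> h hcl; have Cc := aG.2.2.1 point (ap h point).
  have : compact (act_hom @` [set g | a g point = ap h point]).
    apply: continuous_compact => //.
    by apply: continuous_subspaceT => g; apply: act_hom_continuous.
  move=> /(compact_closed perm_group_hausdorff) Ccl.
  have [g _ <-] : (act_hom @` [set g | a g point = ap h point]) h; last by exists g.
  apply: Ccl => U Uh.
  have [_ [[g _ <-] [gh Ug]]] := hcl _ (filterI (perm_group_near h point) Uh).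
  by exists (act_hom g); split=> //; exists g.
(* Cocompactness: the compact set consists of the permutations sending [point] into [K], a finite
   set meeting all orbits. *)
have [K [Kfin KP]] := aG.2.2.2.
exists (\bigcup_(k in K) [set h | ap h point = k]); split.
  by apply: finite_bigcup_compact => // k; apply: perm_group_stab_compact.
move=> h; have [g [k [Kk gk]]] := KP (ap h point).
have [e [inv [mA [m1 [mV _]]]]] := GP.2.2.
have aE : forall v, a e v = v.
  move=> v; have [I [R [SE _]]] := SP; have [/bij_inj ei _] := (SE _).1 (aS e).
  by apply: ei; have := aG.1 e e; rewrite m1 => /(congr1 (fun f => f v)).
have aV : cancel (a g) (a (inv g)).
  by move=> v; have := aG.1 (inv g) g; rewrite mV => /(congr1 (fun f => f v))/= <-.
have [I [R [SE _]]] := SP; have [/bij_inj vi _] := (SE _).1 (aS (inv g)).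
exists g, (tg_mul (act_hom (inv g)) h); split.
  by exists k => //=; rewrite /ap /= -[X in a _ X = _]gk aV.
apply: perm_groupP => v; rewrite /ap /=.
by apply: vi; rewrite aV.
Qed.

End Copci.

End PermutationGroup.

(** * Coloured trees and blow-ups *)

(** Elements of one colour are matched by their position in the two lists, and the colour classes
    are then put together. *)
Lemma colored_bijection (T T' D : eqType) (A : T -> Prop) (B : T' -> Prop)
    (k : T -> D) (k' : T' -> D) (a0 : T') :
  (forall d, exists l l', [/\ uniq l, uniq l', size l = size l',
     forall x, x \in l <-> A x /\ k x = d &
     forall y, y \in l' <-> B y /\ k' y = d]) ->
  exists b : T -> T', [/\ forall x, A x -> B (b x) /\ k' (b x) = k x,
    forall x y, A x -> A y -> b x = b y -> x = y &
    forall y, B y -> exists2 x, A x & b x = y].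
Proof.
move=> /choice[l /choice[l' lP]].
pose b x := nth a0 (l' (k x)) (index x (l (k x))).
have bP x : A x -> B (b x) /\ k' (b x) = k x.
  move=> Ax; have [_ _ sl lE /(_ (b x))[+ _]] := lP (k x); apply.
  by apply: mem_nth; rewrite -sl index_mem; apply/lE.
exists b; split=> //.
  move=> x y Ax Ay bxy; have kxy : k x = k y.
    by rewrite -(bP x Ax).2 -(bP y Ay).2 bxy.
  have [_ ul' sl lE _] := lP (k x).
  have xl : x \in l (k x) by apply/lE.
  have yl : y \in l (k x) by apply/lE.
  move: bxy; rewrite /b -kxy => /eqP.
  rewrite nth_uniq -?sl ?index_mem // => /eqP ixy.
  by rewrite -(nth_index x xl) ixy nth_index.
move=> y By; have [ul ul' sl lE l'E] := lP (k' y).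
have yl' : y \in l' (k' y) by apply/l'E.
have il : (index y (l' (k' y)) < size (l (k' y)))%N by rewrite sl index_mem.
have [x0 _] : exists x0 : T, true by case: (l (k' y)) il => // x0 _ _; exists x0.
pose x := nth x0 (l (k' y)) (index y (l' (k' y))).
have /lE[Ax kx] : x \in l (k' y) by apply: mem_nth.
by exists x => //; rewrite /b kx /x index_uniq // nth_index.
Qed.

Lemma colored_bijection_at (T T' D : eqType) (A : T -> Prop) (B : T' -> Prop)
    (k : T -> D) (k' : T' -> D) (b : T -> T') x0 y0 :
  [/\ forall x, A x -> B (b x) /\ k' (b x) = k x,
    forall x y, A x -> A y -> b x = b y -> x = y &
    forall y, B y -> exists2 x, A x & b x = y] ->
  A x0 -> B y0 -> k x0 = k' y0 ->
  exists b' : T -> T', b' x0 = y0 /\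
    [/\ forall x, A x -> B (b' x) /\ k' (b' x) = k x,
    forall x y, A x -> A y -> b' x = b' y -> x = y &
    forall y, B y -> exists2 x, A x & b' x = y].
Proof.
move=> [bP binj bsurj] Ax0 By0 kxy.
pose sw y := if y == y0 then b x0 else if y == b x0 then y0 else y.
have swK : involutive sw.
  move=> y; rewrite /sw; case: (eqVneq y y0) => [->|yy0].
    by rewrite !eqxx; case: eqVneq => [->|].
  case: (eqVneq y (b x0)) => [->|yb]; first by rewrite eqxx.
  by rewrite (negPf yy0) (negPf yb).
have swP y : B y -> B (sw y) /\ k' (sw y) = k' y.
  move=> By; rewrite /sw; case: eqVneq => [->|_].
    by rewrite (bP x0 Ax0).2; split=> //; apply: (bP x0 Ax0).1.
  by case: eqVneq => [->|_] //; rewrite (bP x0 Ax0).2.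
exists (sw \o b); split; first by rewrite /= /sw !eqxx; case: eqVneq => [->|].
split.
- move=> x Ax /=; have [Bb kb] := bP x Ax.
  by split; [apply: (swP _ Bb).1 | rewrite (swP _ Bb).2].
- by move=> x y Ax Ay /= /(inv_inj swK); apply: binj.
- move=> y By; have [x Ax bx] := bsurj _ (swP y By).1.
  by exists x => //=; rewrite bx swK.
Qed.

(** Equal counts give a label-preserving bijection between the neighbours of matched vertices;
    corrected to send parent to parent, it restricts to children, and [mE] passes colours and
    reversed labels on to the next level. It serves both for transitivity on the regular tree and
    for recognising the blow-up. *)
Lemma edge_colored_iso (V V' C D : eqType) E E' (r : V) (r' : V') par par'
    (k : V -> C) (k' : V' -> C) (m : V -> V -> D) (m' : V' -> V' -> D) :
  rooted E r par -> rooted E' r' par' -> k r = k' r' ->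
  (forall x v w u, E x w -> E' v u -> k x = k' v -> m x w = m' v u ->
     k w = k' u /\ m w x = m' u v) ->
  (forall x v, k x = k' v -> forall d, exists l l',
     [/\ uniq l, uniq l', size l = size l',
      forall w, w \in l <-> E x w /\ m x w = d &
      forall w, w \in l' <-> E' v w /\ m' v w = d]) ->
  exists f : V -> V', [/\ bijective f, f r = r', forall v, k' (f v) = k v,
    forall v w, E v w <-> E' (f v) (f w) &
    forall v w, E v w -> m' (f v) (f w) = m v w].
Proof.
move=> R R' kr mE cnt.
pose M x v := [/\ k x = k' v, x = r <-> v = r' &
  x <> r -> m x (par x) = m' v (par' v)].
have Mr : M r r' by split.
have childE x w : w <> r -> par w = x -> E x w.
  by move=> wr <-; apply/(rooted_sym R)/(rooted_par R).
have childE' x w : w <> r' -> par' w = x -> E' x w.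
  by move=> wr <-; apply/(rooted_sym R')/(rooted_par R').
have [|f [fbij fr fM fpar fE]] := rooted_iso R R' Mr.
  move=> x v [kxv xr mxv].
  have [b [bp [bP binj bsurj]]] : exists b : V -> V',
      (x <> r -> b (par x) = par' v) /\
    [/\ forall w, E x w -> E' v (b w) /\ m' v (b w) = m x w,
    forall w u, E x w -> E x u -> b w = b u -> w = u &
    forall u, E' v u -> exists2 w, E x w & b w = u].
    have [b bP] := colored_bijection r' (cnt x v kxv).
    have [x_r|/eqP xr0] := eqVneq x r; first by exists b.
    have vr0 : v <> r' by move/xr.
    have [b' [b'x b'P]] :=
      colored_bijection_at bP (rooted_par R xr0) (rooted_par R' vr0) (mxv xr0).
    by exists b'.
  exists b; split.
    move=> w wr pw; have Exw := childE _ _ wr pw.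
    have [Evb mb] := bP w Exw.
    have [kw mw] := mE _ _ _ _ Exw Evb kxv (esym mb).
    have [[vr bv]|[br vb]] := (R'.2.2 _ _).1 Evb.
      have xr0 : x <> r by move/xr.
      case: (par2_neq R wr); rewrite pw; apply: esym; apply: binj => //.
      - exact: (rooted_par R xr0).
      - by rewrite bv bp.
    split=> //; split=> //.
    by move=> _; rewrite pw -vb.
  split.
    by move=> w u wr pw ur pu; apply: binj; apply: childE.
  move=> u ur pu; have [w Exw bw] := bsurj _ (childE' _ _ ur pu).
  have [[xr0 wx]|[wr xw]] := (R.2.2 _ _).1 Exw; last by exists w.
  by case: (par2_neq R' ur); rewrite pu -bw wx bp.
exists f; split=> //; first by move=> v; have [] := fM v.
have up v : v <> r -> m' (f v) (f (par v)) = m v (par v).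
  by move=> vr; have [_ _ ->//] := fM v; rewrite fpar.
move=> v w Evw; have [[vr ->]|[wr vw]] := (R.2.2 _ _).1 Evw; first exact: up.
have Ewv := rooted_sym R Evw.
have kw : k w = k' (f w) by have [] := fM w.
have muw : m w v = m' (f w) (f v) by rewrite vw up.
by have [_ ->] := mE _ _ _ _ Ewv ((fE _ _).1 Ewv) kw muw.
Qed.

(** * Blowing up the vertices of a labelled tree *)

Section BlowUp.
Variables (X : eqType) (C : finType) (L : Type).
Variables (nb : X -> L -> X) (lab : L -> C * C).
Let adj s t := exists b, t = nb s b.
Variables (o : X) (par : X -> X).
Hypothesis R : rooted adj o par.
Hypothesis nb_inj : forall s, injective (nb s).
Hypothesis nbV : forall s b, exists b', nb (nb s b) b' = s /\
  lab b' = ((lab b).2, (lab b).1).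
Variables (inC : C -> C -> Prop) (c0 : C) (tau : C -> C).
Hypothesis RC : rooted inC c0 tau.

(** The pair [(s, i)] is the vertex of colour [i] in the copy of the tree [inC] that replaces [s]; a
    letter labelled [(i, j)] at [s] becomes an edge from colour [i] in this copy to colour [j] in
    the neighbouring one. *)
Definition blow_up (x y : X * C) : Prop :=
  (x.1 = y.1 /\ inC x.2 y.2) \/
  exists b, lab b = (x.2, y.2) /\ y.1 = nb x.1 b.

Lemma blow_up_sym x y : blow_up x y -> blow_up y x.
Proof.
move=> [[xy cxy]|[b [lb yE]]]; first by left; split=> //; apply: (rooted_sym RC).
right; have [b' [b'x lb']] := nbV x.1 b.
by exists b'; rewrite lb' lb yE b'x.
Qed.

Lemma blow_up_rooted : exists p, rooted blow_up (o, c0) p.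
Proof.
have /choice[Tau TauP] : forall c, exists t, rooted inC c t.
  by move=> c; apply: reroot RC.
have /choice[e eP] : forall s, exists e : C * C, s <> o ->
    exists b, par s = nb s b /\ lab b = e.
  move=> s; have [->|/eqP so] := eqVneq s o; first by exists (c0, c0).
  by have [b bE] := rooted_par R so; exists (lab b) => _; exists b.
(* The edge from the copy of [s] towards the root leaves at colour [top s]. Parents inside a copy
   lead to that vertex, and from there across the edge; the copy of [o] is rooted at [c0]. *)
pose top s := if s == o then c0 else (e s).1.
pose p (x : X * C) : X * C := if x.2 == top x.1 then
    (if x.1 == o then (o, c0) else (par x.1, (e x.1).2))
  else (x.1, Tau (top x.1) x.2).
exists p; split; first by rewrite /p /= /top !eqxx.
split.
  move=> [s c]; move: s c; apply: (rooted_ind R) => [|s so IH].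
    apply: (rooted_ind (TauP c0)); first by exists 0%N.
    move=> c cc [k kP]; exists k.+1; rewrite iterSr -kP; congr iter.
    by rewrite /p /top /= eqxx; case: eqP.
  apply: (rooted_ind (TauP (top s))) => [|c cc [k kP]].
    have [k kP] := IH (e s).2; exists k.+1; rewrite iterSr -kP; congr iter.
    by rewrite /p /= eqxx; case: eqP so.
  by exists k.+1; rewrite iterSr -kP; congr iter; rewrite /p /=; case: eqP.
have upE s b : s <> o -> nb s b = par s -> lab b = (top s, (e s).2).
  move=> so nbp; have [b' [pb' le]] := eP s so.
  have -> : b = b' by apply: (@nb_inj s); rewrite nbp.
  by rewrite le /top; case: eqP so => // _ _; case: (e s).
have pE x : x <> (o, c0) -> blow_up x (p x).
  case: x => s c sc; rewrite /p /=; case: eqP => [ct|ct]; last first.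
    by left; split=> //=; apply: (rooted_par (TauP _) ct).
  case: eqP => [so|so]; first by case: sc; rewrite ct so /top eqxx.
  by right; have [b [pb le]] := eP s so; exists b; rewrite (upE s b) //= ct.
have down s b : s <> o -> nb s b = par s ->
    (s, (lab b).1) <> (o, c0) /\ (nb s b, (lab b).2) = p (s, (lab b).1).
  move=> so nbp; rewrite (upE s b) //; split; first by case.
  by rewrite /p /= eqxx nbp; case: eqP.
move=> x y; split; last first.
  by move=> [[xo ->]|[yo ->]]; [|apply: blow_up_sym]; apply: pE.
case: x y => [s c] [t d] [[/= <- cd]|[b /= [lb ->]]].
  have [[ct ->]|[dt ->]] := ((TauP (top s)).2.2 _ _).1 cd; [left|right].
    split; last by rewrite /p /=; case: eqP ct.
    by move=> [so co]; apply: ct; rewrite co /top so eqxx.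
  split; last by rewrite /p /=; case: eqP dt.
  by move=> [so co]; apply: dt; rewrite co /top so eqxx.
have [[so /(down _ _ so)]|[to sE]] : (s <> o /\ nb s b = par s) \/
    (nb s b <> o /\ s = par (nb s b)) by apply/R.2.2; exists b.
  by rewrite lb; left.
right; have [b' [b's lb']] := nbV s b.
have := down (nb s b) b' to; rewrite b's => /(_ sE).
by rewrite lb' lb.
Qed.

End BlowUp.

(** * The regular tree *)

Section RegularTree.
Variable n : nat.
Local Notation word := (seq 'I_n).
Local Notation reduced := (sorted (fun a b : 'I_n => a != b)).

Lemma reduced_rcons (s : word) a : reduced (rcons s a) <->
  reduced s /\ forall u, s <> rcons u a.
Proof.
case: (lastP s) => [|u b]; first by split=> // _; split=> // -[].
have -> : reduced (rcons (rcons u b) a) = reduced (rcons u b) && (b != a).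
  case: u => [|x u] /=; first by rewrite andbT.
  by rewrite rcons_path last_rcons.
split=> [/andP[-> /eqP ba]|[-> ua]]; last first.
  by apply/eqP => ba; apply: (ua u); rewrite ba.
by split=> // v /rcons_inj[].
Qed.

(** On reduced words this is right multiplication by the generator [a] in the free product of [n]
    groups of order 2, whose Cayley graph is the [n]-regular tree. *)
Definition word_step (s : word) (a : 'I_n) : word :=
  if ohead (rev s) == Some a then rev (behead (rev s)) else rcons s a.

Lemma word_step_back s a : word_step (rcons s a) a = s.
Proof. by rewrite /word_step rev_rcons /= eqxx revK. Qed.

Lemma word_step_ahead s a : (forall u, s <> rcons u a) ->
  word_step s a = rcons s a.
Proof.
case: (lastP s) => [|u b sa] //; rewrite /word_step rev_rcons /=.
by case: eqP => // -[ba]; case: (sa u); rewrite ba.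
Qed.

Lemma rconsP (s : word) a :
  (exists u, s = rcons u a) \/ (forall u, s <> rcons u a).
Proof.
have [|nex] := pselect (exists u, s = rcons u a); first by left.
by right=> u su; apply: nex; exists u.
Qed.

Lemma word_step_reduced s a : reduced s -> reduced (word_step s a).
Proof.
have [[u ->]|sa] := rconsP s a.
  by rewrite word_step_back => /reduced_rcons[].
by rewrite word_step_ahead // => rs; apply/reduced_rcons.
Qed.

Lemma word_stepK s a : reduced s -> word_step (word_step s a) a = s.
Proof.
have [[u ->] /reduced_rcons[_ ua]|sa _] := rconsP s a.
  by rewrite word_step_back word_step_ahead.
by rewrite [word_step s a]word_step_ahead // word_step_back.
Qed.

Lemma word_step_inj s : injective (word_step s).
Proof.
move=> a b; have [[u ->]|sa] := rconsP s a.
  rewrite word_step_back; have [[v /rcons_inj[-> ->]]//|ub] := rconsP (rcons u a) b.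
  by rewrite word_step_ahead // => /(congr1 size); rewrite !size_rcons; lia.
rewrite word_step_ahead //; have [[v ->]|sb] := rconsP s b.
  by rewrite word_step_back => /(congr1 size); rewrite !size_rcons; lia.
by rewrite word_step_ahead // => /rcons_inj[].
Qed.

Lemma Tn_adjE (x y : Tn_vert n) :
  Tn_adj x y <-> exists a, val y = word_step (val x) a.
Proof.
split=> [[[a ya]|[a xa]]|[a]]; rewrite ?ya ?xa.
- exists a; have := valP y; rewrite ya => /reduced_rcons[_ xa].
  by rewrite word_step_ahead.
- by exists a; rewrite word_step_back.
have [[u xu]|xa] := rconsP (val x) a.
  by rewrite xu word_step_back => yu; right; exists a; rewrite xu yu.
by rewrite word_step_ahead // => ya; left; exists a.
Qed.

Lemma Tn_rooted : exists par, rooted (@Tn_adj n) point par.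
Proof.
have /choice[par parE] : forall x : Tn_vert n, exists y : Tn_vert n,
    val y = rev (behead (rev (val x))).
  case=> s /= rs; case: (lastP s) rs => [|u b] rs; first by exists point.
  rewrite rev_rcons /= revK.
  by have /reduced_rcons[ru _] := rs; exists (exist _ u ru).
have nil (x : Tn_vert n) : val x = [::] -> x = point by move=> ?; apply: val_inj.
have par_rcons (x y : Tn_vert n) a : val y = rcons (val x) a -> x = par y.
  by move=> ya; apply: val_inj; rewrite parE ya rev_rcons /= revK.
have rcons_neq (x : Tn_vert n) u a : val x = rcons u a -> x <> point.
  by move=> xu xp; move: xu; rewrite xp; case: u.
exists par; split; first exact/nil/parE.
split=> [x|x y].
  exists (size (val x)); move: {2}(size _) (erefl (size (val x))) => m.
  elim: m x => [x /size0nil/nil -> //|m IH x sx].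
  rewrite sx iterSr; apply: etrans (IH (par x) _); first last.
    by rewrite parE size_rev size_behead size_rev sx.
  by rewrite parE size_rev size_behead size_rev sx.
split=> [[[a ya]|[a xa]]|].
- by right; split; [apply: rcons_neq ya|apply: par_rcons ya].
- by left; split; [apply: rcons_neq xa|apply: par_rcons xa].
have down (z : Tn_vert n) : z <> point -> exists a, val z = rcons (val (par z)) a.
  move=> zp; rewrite parE; case: (lastP (val z)) (nil z) => [/(_ erefl)//|u b _].
  by exists b; rewrite rev_rcons /= revK.
by move=> [[/down ? ->]|[/down ? ->]]; [right|left].
Qed.

(** * Edge labellings of the regular tree *)

Section Labelling.
Variables (C : Type) (lab : 'I_n -> C * C) (opp : 'I_n -> 'I_n).
Hypothesis labV : forall a, lab (opp a) = ((lab a).2, (lab a).1).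

(* The labels of the edges at the vertex [rcons s a] are those prescribed by
   the letters, except that the letter [a], leading back to [s], is swapped with
   one whose label is the reverse of the label read from [s]. *)
Fixpoint relabel (s : word) : {perm 'I_n} :=
  if s is a :: t then tperm a (opp (relabel t a)) else perm_one 'I_n.

(** The edge at [x] in the direction of the letter [a] is given the index [relabel (rev (val x)) a].
    The transposition in [relabel] ensures that the two indices of an edge carry reversed labels. *)
Lemma Tn_labelled : exists nb : Tn_vert n -> 'I_n -> Tn_vert n,
  [/\ forall x, injective (nb x),
    forall x y, Tn_adj x y <-> exists b, y = nb x b &
    forall x b, exists b', nb (nb x b) b' = x /\
      lab b' = ((lab b).2, (lab b).1)].
Proof.
pose rl (x : Tn_vert n) := relabel (rev (val x)).
have /choice[nb0 nb0E] : forall p : Tn_vert n * 'I_n, exists y : Tn_vert n,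
    val y = word_step (val p.1) p.2.
  by move=> [[s rs] a]; exists (exist _ (word_step s a) (word_step_reduced a rs)).
pose nb x b := nb0 (x, (rl x)^-1%g b).
have nbE x b : val (nb x b) = word_step (val x) ((rl x)^-1%g b) by rewrite nb0E.
exists nb; split.
- by move=> x b b' /(congr1 val); rewrite !nbE => /word_step_inj/perm_inj.
- move=> x y; rewrite Tn_adjE; split=> [[a ya]|[b ->]].
    by exists (rl x a); apply: val_inj; rewrite nbE permK.
  by rewrite nbE; exists ((rl x)^-1%g b).
move=> x b; set a := (rl x)^-1%g b; set y := nb x b.
have yE : val y = word_step (val x) a by rewrite nbE.
have nby : nb y (rl y a) = x.
  by apply: val_inj; rewrite nbE permK yE word_stepK //; apply: valP.
have ba : b = rl x a by rewrite permKV.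
(* It suffices to compare the ends of an edge leading away from the empty word; reversing a label
   twice handles the other direction. *)
have lab_rcons (z w : Tn_vert n) : val w = rcons (val z) a ->
    lab (rl w a) = ((lab (rl z a)).2, (lab (rl z a)).1).
  by move=> wz; rewrite {1}/rl wz rev_rcons /= tpermL labV.
exists (rl y a); split=> //.
have [[u xu]|xa] := rconsP (val x) a.
  have xy : val x = rcons (val y) a by rewrite xu yE xu word_step_back.
  by rewrite ba (lab_rcons _ _ xy); case: (lab (rl y a)).
by rewrite ba; apply: lab_rcons; rewrite yE word_step_ahead.
Qed.

End Labelling.
End RegularTree.

(** * Reduction of the number of orbits *)

(** Here [top w] is the vertex of the fibre over [w] closest to the root. Every other vertex of the
    fibre has its parent in the fibre, so fibres are subtrees and contracting them leaves a tree. *)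
Lemma contraction_rooted (V W : eqType) (E : V -> V -> Prop) (r : V) par
    (p : V -> W) (top : W -> V) :
  rooted E r par -> (forall w, p (top w) = w) -> top (p r) = r ->
  (forall v, v <> top (p v) -> p (par v) = p v) ->
  (forall w, top w <> r -> p (par (top w)) <> w) ->
  rooted (fun w w' => w <> w' /\ exists v v', [/\ E v v', p v = w & p v' = w'])
    (p r) (fun w => p (par (top w))).
Proof.
move=> R pK topr below above; split; first by rewrite topr R.1.
have up v w : v <> r -> p v = w -> p (par v) <> w ->
    w <> p r /\ p (par v) = p (par (top w)).
  move=> vr pv pw; have [vt|/eqP/below] := eqVneq v (top (p v)); last first.
    by rewrite pv.
  by rewrite -pv -vt; split=> // pvr; apply: vr; rewrite vt pvr topr.
split.
  move=> w; rewrite -(pK w); move: (top w); apply: (rooted_ind R).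
    by exists 0%N.
  move=> v vr [k kP]; have [<-|/eqP pv] := eqVneq (p (par v)) (p v); first by exists k.
  by have [_ pE] := up _ _ vr erefl pv; exists k.+1; rewrite iterSr -pE.
have lift w : w <> p r -> w <> p (par (top w)) /\
    exists v v', [/\ E v v', p v = w & p v' = p (par (top w))].
  move=> wr; have tr : top w <> r by move=> tr; apply: wr; rewrite -tr pK.
  split; first by apply/nesym/above.
  by exists (top w), (par (top w)); split=> //; apply: (rooted_par R).
move=> w w'; split.
  move=> [ww' [v [v' [Evv' pv pv']]]].
  have [[vr vE]|[vr vE]] := (R.2.2 _ _).1 Evv'; [left|right].
    by rewrite -pv' vE; apply: up => //; rewrite -vE pv'; apply: nesym.
  by rewrite -pv vE; apply: up => //; rewrite -vE pv.
move=> [[/lift[ne [v [v' [vv' pv pv']]]] ->]|[/lift[ne [v [v' [vv' pv pv']]]] ->]].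
  by split=> //; exists v, v'.
split; first exact: nesym.
by exists v', v; split=> //; apply: (rooted_sym R).
Qed.

(* A geometric action on a locally finite tree whose vertex orbits are the
   (possibly empty) fibers of [c]. *)
Definition colored_action (G : tgroup) (k : nat) (V : pointedType)
    (E : V -> V -> Prop) (a : G -> V -> V) (c : V -> 'I_k) : Prop :=
  [/\ exists r par, rooted E r par, locally_finite_graph E,
    forall g, tree_automorphism E (a g), geometric a &
    forall x y, c x = c y <-> exists g, a g x = y].

Lemma action_inverse (G : tgroup) (V : pointedType) (a : G -> V -> V) :
  is_lcgroup G -> (forall g, bijective (a g)) ->
  (forall g h, a (tg_mul g h) = a g \o a h) ->
  exists (e : G) (inv : G -> G), (forall v, a e v = v) /\
    (forall g, cancel (a g) (a (inv g)) /\ cancel (a (inv g)) (a g)).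
Proof.
move=> [_ [_ [e [inv [mA [m1 [mV _]]]]]]] abij aM.
have ae v : a e v = v.
  by apply: (bij_inj (abij e)); have := aM e e; rewrite m1 => /(congr1 (@^~ v)).
exists e, inv; split=> // g.
have aV : cancel (a g) (a (inv g)).
  by move=> v; have := aM (inv g) g; rewrite mV => /(congr1 (@^~ v))/= <-.
by split=> // v; apply: (bij_inj (abij (inv g))); rewrite aV.
Qed.

Lemma orbit_coloring (G : tgroup) (V : pointedType) (E : V -> V -> Prop)
    (a : G -> V -> V) : is_lcgroup G -> is_tree E -> locally_finite_graph E ->
  geometric_tree_action E a -> exists k (c : V -> 'I_k), colored_action E a c.
Proof.
move=> Glc tE lf ga; have [aut [aM [_ [_ [K [/finite_seqP[l ->] KP]]]]]] := ga.
have [e [inv [ae aV]]] := action_inverse Glc (fun g => (aut g).1) aM.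
pose same x y := exists g, a g x = y.
pose f x := find (fun y => `[< same y x >]) l.
have fl x : (f x < size l)%N.
  rewrite -has_find; apply/hasP; have [g [y [yl gy]]] := KP x.
  by exists y => //; apply/asboolP; exists g.
exists (size l), (fun x => Ordinal (fl x)); split=> //.
- by exists point; apply: tree_rooted.
- exact: geometric_tree_actionW ga.
have nthf x : same (nth point l (f x)) x.
  by apply/asboolP; apply: (nth_find point (a := fun y => `[< same y x >]));
     rewrite has_find; apply: fl.
have same_sym x y : same x y -> same y x.
  by move=> [g <-]; exists (inv g); apply: (aV g).1.
have same_trans x y z : same x y -> same y z -> same x z.
  by move=> [g <-] [h <-]; exists (tg_mul h g); rewrite aM.
move=> x y; split=> [[fxy]|xy].
  have := nthf x; rewrite fxy => /same_sym xn.
  exact: (same_trans _ _ _ xn (nthf y)).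
apply: val_inj => /=; apply: eq_find => z; apply/asboolP/asboolP => zx.
  exact: same_trans zx xy.
exact: same_trans zx (same_sym _ _ xy).
Qed.

Lemma drop_color (V : Type) k (c : V -> 'I_k.+1) (i : 'I_k.+1) :
  (forall x, c x <> i) -> exists c' : V -> 'I_k, forall x, c x = lift i (c' x).
Proof.
move=> ci; suff /choice[c' c'E] : forall x, exists j, c x = lift i j by exists c'.
by move=> x; have /eqP/unlift_some[j -> _] := nesym (ci x); exists j.
Qed.

Section Contraction.
Variables (G : tgroup) (k : nat) (V : pointedType) (E : V -> V -> Prop).
Variables (a : G -> V -> V) (c : V -> 'I_k.+1) (i j : 'I_k.+1).
Hypotheses (Glc : is_lcgroup G) (ca : colored_action E a c) (ij : i <> j).
Hypothesis nbr : forall x, c x = i -> exists y, [/\ E x y, c y = j &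
  forall z, E x z -> c z = j -> z = y].

(** Each vertex of colour [i] is merged into its neighbour of colour [j]. Uniqueness of that
    neighbour makes the merging equivariant, the fibres are finite stars, and the colour [i]
    disappears. *)
Lemma contract_color : exists (W : pointedType) (F : W -> W -> Prop)
  (b : G -> W -> W) (d : W -> 'I_k), colored_action F b d.
Proof.
have [[r0 [par0 R0]] lf aut ga cE] := ca.
have [e [inv [ae aV]]] := action_inverse Glc (fun g => (aut g).1) ga.1.
have /choice[q qP] : forall x, exists y, c x = i -> [/\ E x y, c y = j &
    forall z, E x z -> c z = j -> z = y].
  move=> x; have [/nbr[y yP]|cx] := pselect (c x = i); first by exists y.
  by exists x.
pose p0 x := if c x == i then q x else x.
have p0i x : c (p0 x) <> i.
  rewrite /p0; case: eqP => [/qP[_ -> _]|//]; exact: nesym.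
have ca_g g x : c (a g x) = c x by apply/esym/cE; exists g.
have p0a g x : p0 (a g x) = a g (p0 x).
  rewrite /p0 ca_g; case: eqP => // cx; have [xq cq _] := qP _ cx.
  have [_ _ uniq] := qP (a g x) (etrans (ca_g _ _) cx).
  by apply: esym; apply: uniq; [apply/(aut g).2|rewrite ca_g].
pose w0 : {x : V | c x != i} := exist _ (p0 point) (introN eqP (@p0i point)).
pose W : pointedType := HB.pack {x : V | c x != i} (isPointed.Build _ w0).
pose p (x : V) : W := exist (fun x => c x != i) (p0 x) (introN eqP (@p0i x)).
have pE (w : W) x : p x = w <-> p0 x = val w.
  by split=> [<- //|pw]; apply: val_inj.
have p_val (w : W) : p (val w) = w.
  by apply/pE; rewrite /p0 (negPf (valP w)).
(* The root is moved to a vertex whose colour is not [i], so that it is the top of its own fibre. *)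
have [par R] := reroot (val w0) R0.
(* The fibre is a star centred at [w], so its highest vertex is [w], or the parent of [w] if that
   parent is merged into [w]. *)
pose top (w : W) : V := if p (par (val w)) == w then par (val w) else val w.
have p0near x : p0 x = x \/ (c x = i /\ E x (p0 x)).
  rewrite /p0; case: eqP => [cx|]; last by left.
  by right; split=> //; have [] := qP _ cx.
have pr : p (val w0) = w0 by apply: p_val.
have Rb := contraction_rooted (top := top) R _ _ _ _.
pose F (w w' : W) := w <> w' /\ exists v v', [/\ E v v', p v = w & p v' = w'].
have {Rb} RF : rooted F w0 (fun w => p (par (top w))).
  rewrite -{1}pr; apply: Rb.
  - by move=> w; rewrite /top; case: eqP.
  - by rewrite /top pr R.1 pr eqxx.
  - move=> v; rewrite /top; have [pv|[cv Ev]] := p0near v.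
      have -> : val (p v) = v by [].
      by case: eqP.
    have valp : val (p v) = p0 v by [].
    have [[vr pv]|[pvr vp]] := (R.2.2 _ _).1 Ev.
      by move=> _; apply/pE; rewrite -pv valp /p0 (introF eqP (@p0i v)).
    by rewrite valp -vp eqxx.
  move=> w; rewrite /top; case: eqP => [pw tr|//].
  have wr : val w <> val w0 by move=> wr; apply: tr; rewrite wr R.1.
  have cpw : c (par (val w)) = i.
    have [pp|[]//] := p0near (par (val w)).
    by case: (par_neq R wr); rewrite -pp; apply/pE.
  move=> /pE; have [->|[_]] := p0near (par (par (val w))).
    exact: (par2_neq R wr).
  move=> + ppE; rewrite ppE => /(R.2.2 _ _).1 [[ppr wE]|[_ wE]].
    have [d [d0 dS]] := rooted_depth R.
    have := dS _ wr; have := dS _ tr; have := dS _ ppr; rewrite -wE => -> ->.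
    by move: (d _) => m; lia.
  exact: (par_neq R tr wE).
pose b g (w : W) : W := p (a g (val w)).
have bp g x : b g (p x) = p (a g x).
  by apply/pE; rewrite p0a /= p0a; congr a; rewrite {1}/p0 (introF eqP (@p0i x)).
have fib w : finite_set [set v | p v = w].
  apply: (@sub_finite_set _ _ ([set val w] `|` [set v | E (val w) v])).
    move=> v /= /pE pv; have [vv|[_ Ev]] := p0near v; [left|right].
      by rewrite -pv vv.
    by apply: (rooted_sym R); rewrite -pv.
  by rewrite finite_setU; split=> //; apply: lf.
have gb : geometric b by apply: (geometric_pushforward ga bp) => // w; exists (val w).
have bV g : cancel (b g) (b (inv g)) /\ cancel (b (inv g)) (b g).
  by split=> w; rewrite -{1}(p_val w) !bp ?(aV g).1 ?(aV g).2 p_val.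
have bF g w w' : F w w' -> F (b g w) (b g w').
  move=> [ww' [v [v' [vv' pv pv']]]]; split.
    by move=> /(can_inj (bV g).1).
  exists (a g v), (a g v'); rewrite -!bp pv pv'; split=> //.
  by apply/(aut g).2.
have ci (w : W) : c (val w) <> i by apply/eqP/(valP w).
have [d dE] := drop_color ci.
exists W, F, b, d; split.
- by exists w0; eexists; apply: RF.
- move=> w; have := bigcup_finite (fib w) (fun v _ => lf v).
  move=> /(finite_image p); apply: sub_finite_set.
  by move=> w' [_ [v [v' [vv' pv pv']]]]; exists v' => //; exists v.
- move=> g; split; first by exists (b (inv g)); case: (bV g).
  by move=> w w'; split=> [/(bF (inv g))|/bF//]; rewrite !(bV g).1.
- by [].
move=> w w'; transitivity (c (val w) = c (val w')).
  by rewrite !dE; split=> [->//|/lift_inj].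
rewrite cE; split=> [[g gw]|[g gw]]; exists g.
  by rewrite /b gw p_val.
by move/pE: gw; rewrite /p0 ca_g (negPf (valP w)).
Qed.

End Contraction.

(** * Elementary groups *)

Lemma compact_elementary (G : tgroup) : compact [set: G] -> ~ non_elementary G.
Proof.
move=> Gc; apply; exists (fun _ x => x); split=> //; split=> //; split.
  by move=> p; apply: cvg_snd.
move=> K _; have [[k Kk]|nK] := pselect (exists k, K k).
  by move: Gc; congr compact; rewrite predeqE => g; split=> // _; exists k.
rewrite (_ : [set g | _] = set0); first exact: compact0.
by rewrite predeqE => g; split=> // -[k [Kk _]]; apply: nK; exists k.
Qed.

Lemma finite_elementary (G : tgroup) (V : pointedType) (a : G -> V -> V) :
  geometric a -> finite_set [set: V] -> ~ non_elementary G.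
Proof.
move=> ga Vfin; apply: compact_elementary.
have := finite_bigcup_compact Vfin (ga.2.2.1 point); congr compact.
by rewrite predeqE => g; split=> // _; exists (a g point).
Qed.

(** * Groups acting on a line *)

Definition int_adj (x y : int) : Prop := y = (x + 1)%R \/ x = (y + 1)%R.

Definition int_par (x : int) : int :=
  match x with Posz n => Posz n.-1 | Negz n.+1 => Negz n | Negz 0 => 0%R end.

Lemma int_parE (x : int) : x <> 0%R ->
  ((0 < x)%R /\ int_par x = (x - 1)%R) \/ ((x < 0)%R /\ int_par x = (x + 1)%R).
Proof.
by case: x => [[|n]|[|n]] //= _; [left|right|right]; split=> //; lia.
Qed.

Lemma int_rooted : rooted int_adj 0%R int_par.
Proof.
split=> //; split.
  case=> n; first by exists n; elim: n => // n IH; rewrite iterSr.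
  by exists n.+1; elim: n => // n IH; rewrite iterSr.
move=> x y; have [->|/eqP x0] := eqVneq x 0%R.
  have [->|/eqP y0] := eqVneq y 0%R; first by rewrite /int_adj; intuition; lia.
  by have := int_parE y0; rewrite /int_adj; intuition; lia.
have [->|/eqP y0] := eqVneq y 0%R.
  by have := int_parE x0; rewrite /int_adj; intuition; lia.
by have := int_parE x0; have := int_parE y0; rewrite /int_adj; intuition; lia.
Qed.

(** With two neighbours everywhere, the root has two children and any other vertex has one, as in
    the integers rooted at 0; so the invariant only has to record which vertex is the root. *)
Lemma line_iso (V : eqType) (E : V -> V -> Prop) r par : rooted E r par ->
  (forall v, exists y z, [/\ y <> z, E v y, E v z &
     forall w, E v w -> w = y \/ w = z]) ->
  exists f : int -> V, bijective f /\
    forall x y, int_adj x y <-> E (f x) (f y).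
Proof.
move=> R two.
have [|x v xv|f [fbij _ _ _ fE]] :=
    rooted_iso (M := fun x v => x = 0%R <-> v = r) int_rooted R _ _.
- by [].
- have notpar w : w <> r -> par w = v -> E v w.
    by move=> wr <-; apply/(rooted_sym R)/(rooted_par R).
  have [y [z [yz vy vz vw]]] := two v.
  have [x0|/eqP x0] := eqVneq x 0%R.
    have vr := xv.1 x0.
    have child w : E v w -> w <> r /\ par w = v.
      by rewrite vr => /R.2.2[] [] // wr <-.
    exists (fun w => if w == 1%R then y else z); split.
      move=> w w0 _; split; last 1 first.
      - split=> // wr; case: (child y vy) (child z vz) => [yr _] [zr _].
        by move: wr; case: eqP => _ wr; [case: yr|case: zr].
      - by case: eqP => _; [case: (child y vy)|case: (child z vz)].
      - by case: eqP => _; [case: (child y vy)|case: (child z vz)].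
    split.
      move=> w1 w2 n1 p1 n2 p2; have := int_parE n1; have := int_parE n2.
      by rewrite p1 p2; do 2! case: eqP => ?; subst=> //; try lia;
        move=> _ _ ?; subst.
    move=> w wr pw; have [->|->] := vw w (notpar w wr pw).
      by exists 1%R; rewrite x0; split.
    by exists (-1)%R; rewrite x0; split.
  have vr : v <> r by move/xv.
  have [u [uv up uE]] : exists u, [/\ u <> r, par u = v &
      forall w, w <> r -> par w = v -> w = u].
    have other y' z' : y' <> z' -> E v y' -> E v z' ->
        (forall w, E v w -> w = y' \/ w = z') -> y' = par v ->
        exists u, [/\ u <> r, par u = v &
          forall w, w <> r -> par w = v -> w = u].
      move=> yz' vy' vz' vw' yp.
      have [[_ zp]|[zr zp]] := (R.2.2 _ _).1 vz'; first by case: yz'; rewrite yp.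
      exists z'; split=> // w wr pw; have [wy|//] := vw' w (notpar w wr pw).
      by case: (par2_neq R wr); rewrite pw -yp wy.
    have [yp|zp] := vw _ (rooted_par R vr); first exact: (other y z).
    apply: (other z y) => //; first exact: nesym.
    by move=> w /vw[]; [right|left].
  exists (fun=> u); split; last split.
  - by move=> w w0 _; split.
  - move=> w1 w2 n1 p1 n2 p2 _.
    have := int_parE n1; have := int_parE n2; rewrite p1 p2 => w2E w1E.
    by move: x0 w2E w1E => /int_parE; lia.
  - move=> w wr pw; rewrite (uE w) //.
    have [xp|xn] : (0 < x)%R \/ (x < 0)%R by lia.
      exists (x + 1)%R; split=> //; first lia.
      by case: (@int_parE (x + 1)%R); lia.
    exists (x - 1)%R; split=> //; first lia.
    by case: (@int_parE (x - 1)%R); lia.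
by exists f.
Qed.

(** Injectivity forbids turning back, so consecutive differences are all equal. *)
Lemma int_automorphism (h : int -> int) : injective h ->
  (forall x y, int_adj x y -> int_adj (h x) (h y)) ->
  [/\ (h 1 - h 0 = 1 \/ h 1 - h 0 = -1)%R &
   forall x, h x = (h 0 + (h 1 - h 0) * x)%R].
Proof.
move=> hinj hadj.
have step x : int_adj (h x) (h (x + 1)%R) by apply: hadj; left.
have same (x : int) : (h (x + 1 + 1) - h (x + 1) = h (x + 1) - h x)%R.
  have h2 : h (x + 1 + 1)%R <> h x by move/hinj; lia.
  move: (step x) (step (x + 1)%R) h2; rewrite /int_adj.
  by move: (h x) (h (x + 1)%R) (h (x + 1 + 1)%R) => p q t; lia.
have s01 : (h (0 + 1) - h 0 = h 1 - h 0)%R by [].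
have all (x : int) : (h (x + 1) - h x = h 1 - h 0)%R.
  elim/int_rec: x => // n IH.
    have -> : Posz n.+1 = (Posz n + 1)%R by lia.
    by rewrite same.
  rewrite -same -IH; have -> : (- Posz n.+1 + 1 = - Posz n)%R by lia.
  by [].
split; first by case: (step 0%R); rewrite add0r; lia.
move=> x; elim/int_rec: x => [|n IH|n IH]; first by rewrite mulr0 addr0.
  have := all (Posz n); have -> : (Posz n + 1)%R = Posz n.+1 by lia.
  have -> : Posz n.+1 = (Posz n + 1)%R by lia.
  by rewrite mulrDr mulr1; lia.
have := all (- Posz n.+1)%R; have -> : (- Posz n.+1 + 1 = - Posz n)%R by lia.
have -> : (- Posz n.+1 = - Posz n - 1)%R by lia.
by rewrite mulrDr mulrN1; lia.
Qed.

(** Automorphisms of the line of integers are affine of slope 1 or -1, so the action extends to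
    isometries of the real line. *)
Lemma line_elementary (G : tgroup) (V : pointedType) (E : V -> V -> Prop) r par
    (a : G -> V -> V) : rooted E r par ->
  (forall g, tree_automorphism E (a g)) -> geometric a ->
  (forall v, exists y z, [/\ y <> z, E v y, E v z &
     forall w, E v w -> w = y \/ w = z]) -> ~ non_elementary G.
Proof.
move=> rE aut ga two; have [f [[fV fK Kf] fE]] := line_iso rE two.
pose h g x := fV (a g (f x)).
have hinj g : injective (h g).
  by move=> x y /(can_inj Kf)/(bij_inj (aut g).1)/(can_inj fK).
have hadj g x y : int_adj x y -> int_adj (h g x) (h g y).
  by move=> xy; apply/fE; rewrite !Kf; apply/(aut g).2/fE.
have hP g := int_automorphism (hinj g) (hadj g).
have hM g g' x : h (tg_mul g g') x = h g (h g' x) by rewrite /h ga.1 /= Kf.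
have hN g x : \forall g' \near g, h g' x = h g x.
  by apply: filterS (ga.2.1 g (f x)) => g' /= agx; rewrite /h agx.
pose s g : int := (h g 1 - h g 0)%R.
pose b g (x : Rdefinitions.R) : Rdefinitions.R := ((h g 0)%:~R + (s g)%:~R * x)%R.
have bN g : \forall g' \near g, b g' = b g.
  apply: filterS2 (hN g 0%R) (hN g 1%R) => g' h0 h1.
  by rewrite /b /s h0 h1.
have s1 g : `|(s g)%:~R : Rdefinitions.R|%R = 1%R.
  have [s1 _] := hP g; rewrite /s; case: s1 => ->; first by rewrite normr1.
  by rewrite mulrN1z normrN normr1.
have bdist g x y : `|b g x - b g y|%R = `|x - y|%R.
  by rewrite /b opprD addrACA subrr add0r -mulrBr normrM s1 mul1r.
apply; exists b; split=> //; split.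
  move=> g g'; apply/funext => x /=; rewrite /b /s !hM.
  rewrite ((hP g).2 (h g' 0%R)) ((hP g).2 (h g' 1%R)) -/(s g).
  by rewrite !(rmorphD, rmorphB, rmorphM, rmorphN) /=; ring.
split.
  move=> [g x] U /= /nbhs_ballP[e /= e0 eU].
  exists ([set g' | b g' = b g], ball x e).
    by split; [apply: bN|apply: nbhsx_ballx].
  have ballE (y z : Rdefinitions.R) : ball y e z = (`|y - z| < e)%R by [].
  by move=> [g' y] [/= -> xy]; apply: eU; rewrite ballE bdist -ballE.
move=> K Kc; have [m0 [m0r mP]] :=
  @compact_bounded _ (Rdefinitions.R^o)%type (K : set (Rdefinitions.R^o)%type) Kc.
pose M := Num.bound (`|m0 + 1|)%R.
have KM x : K x -> (`|x| <= M%:R)%R.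
  move=> Kx; apply: (le_trans (mP (m0 + 1)%R _ x Kx)); first by rewrite ltrDl.
  by apply: (le_trans (ler_norm _)); apply/ltW/archi_boundP.
(* An element moving a point of [K] into [K] sends 0 to an integer of absolute value at most
   [M + M]. *)
have fin : finite_set (f @` [set z | (`|z|%R <= Posz M + Posz M)%R]).
  apply: finite_image; apply: (@sub_finite_set _ _
      (Posz @` `I_(M + M).+1 `|` (fun n => - Posz n)%R @` `I_(M + M).+1)).
    move=> z /= zM; have [z0|z0] : (0 <= z)%R \/ (z < 0)%R by lia.
      by left; exists `|z|%N => /=; lia.
    by right; exists `|z|%N => /=; lia.
  by rewrite finite_setU; split; apply/finite_image/finite_II.
apply: (subclosed_compact _ (finite_bigcup_compact fin (ga.2.2.1 (f 0%R)))).
  rewrite (_ : [set g | _] =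
    [set g | (exists k, K k /\ K (b g k)) = True]).
    by apply: near_const_closed => g; apply: filterS (bN g) => g' /= ->.
  by rewrite predeqE => g /=; split=> [/propT|->].
move=> g [k [Kk Kbk]]; exists (a g (f 0%R)) => //.
exists (h g 0%R); last by rewrite Kf.
have : (`|(h g 0)%:~R : Rdefinitions.R| <= M%:R + M%:R)%R.
  have -> : ((h g 0)%:~R = b g k - (s g)%:~R * k)%R by rewrite /b addrK.
  apply: le_trans (ler_normB _ _) _; apply: lerD; first exact: KM.
  by rewrite normrM s1 mul1r; apply: KM.
rewrite -intr_norm -natrD -[(M + M)%:R%R]/((Posz (M + M))%:~R%R) ler_int /=.
by rewrite PoszD.
Qed.

(** * The commation *)

(** A single relation gives the automorphism group of a tree, one relation per label gives the
    label-preserving automorphisms. *)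
Definition rel_aut (V : pointedType) (I : Type) (R : I -> V -> V -> Prop) :
    set {ptws V -> discrete_topology V} :=
  [set f : {ptws V -> discrete_topology V} | bijective (f : V -> V) /\
     forall i x y, R i (f x) (f y) <-> R i x y].

Lemma rel_aut_comp (V : pointedType) (I : Type) (R : I -> V -> V -> Prop)
    (f g : rel_aut R) :
  (val f \o val g : {ptws V -> discrete_topology V}) \in rel_aut R.
Proof.
apply/mem_set; have [fb fR] := set_valP f; have [gb gR] := set_valP g.
by split=> [|i x y /=]; [apply: bij_comp | rewrite fR gR].
Qed.

Definition rel_aut_group (V : pointedType) (I : Type) (R : I -> V -> V -> Prop) :=
  perm_group (@rel_aut_comp V I R).

(** By induction outwards from [v], the image of [u] is a neighbour of one of the finitely many
    images of its parent. *)
Lemma closed_permutationsI (V : pointedType)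
    (S : set {ptws V -> discrete_topology V}) (I : Type)
    (R : I -> V -> V -> Prop) (E : V -> V -> Prop) r par :
  rooted E r par -> locally_finite_graph E ->
  (forall f, S f <-> bijective f /\ forall i x y, R i (f x) (f y) <-> R i x y) ->
  (forall f, S f -> forall x y, E x y -> E (f x) (f y)) ->
  closed_permutations S.
Proof.
move=> rE lf SE SadjE; exists I, R; split=> // v w.
have [parv rv] := reroot v rE; apply: (rooted_ind rv).
  apply: (@sub_finite_set _ _ [set w]); last exact: finite_set1.
  by move=> x [f _ [-> ->]].
move=> u uv fin; apply: sub_finite_set (bigcup_finite fin (fun t _ => lf t)).
move=> x [f Sf [fv <-]]; exists (f (parv u)); first by exists f.
by apply: SadjE => //; apply/(rooted_sym rv)/(rooted_par rv).
Qed.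

Lemma rel_aut_closed (V : pointedType) (I : Type) (R : I -> V -> V -> Prop)
    (E : V -> V -> Prop) r par :
  rooted E r par -> locally_finite_graph E ->
  (forall x y, E x y <-> exists i, R i x y) -> closed_permutations (rel_aut R).
Proof.
move=> rE lf ER; apply: (closed_permutationsI rE lf (R := R)) => // f [_ fR].
by move=> x y /ER[i xy]; apply/ER; exists i; apply/fR.
Qed.

Lemma Tn_locally_finite n : locally_finite_graph (@Tn_adj n).
Proof.
have [nb [_ nbE _]] := @Tn_labelled n unit (fun=> (tt, tt)) id (fun=> erefl).
move=> x; apply: (@sub_finite_set _ _ (nb x @` [set: 'I_n])).
  by move=> y /nbE[b ->]; exists b.
by apply: finite_image; apply: finite_finset.
Qed.

Lemma AutTn_closed n : closed_permutations (AutTn_set n).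
Proof.
have [par rE] := Tn_rooted n.
apply: (closed_permutationsI rE (@Tn_locally_finite n)
          (R := fun _ : unit => @Tn_adj n)) => [f|f [_ fE] x y /fE//].
by split=> -[fb fE]; split=> //; apply: (fE tt).
Qed.

(** Letters are the positions in a list repeating each pair [p] exactly [M p.1 p.2] times. Any
    letter with the reversed label can serve as [opp b]; since [M i j] and [M j i] may differ, [opp]
    is in general no involution. *)
Lemma letters (C : finType) (M : C -> C -> nat) :
  (forall i j, (0 < M i j)%N -> (0 < M j i)%N) ->
  exists (n : nat) (lab : 'I_n -> C * C) (opp : 'I_n -> 'I_n),
    (forall p, #|[pred b | lab b == p]| = M p.1 p.2) /\
    (forall b, lab (opp b) = ((lab b).2, (lab b).1)).
Proof.
move=> Msym.
pose ls := flatten [seq nseq (M p.1 p.2) p | p <- enum {: C * C}].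
pose lab := tnth (in_tuple ls).
have labE p : #|[pred b | lab b == p]| = M p.1 p.2.
  rewrite cardE size_filter -enumT.
  rewrite -(count_map lab (pred1 p)) map_tnth_enum /= count_flatten -map_comp.
  rewrite sumnE big_map big_enum /= (bigD1 p) //= count_nseq /= eqxx mul1n.
  by rewrite big1 ?addn0 // => q /negPf qp; rewrite count_nseq /= qp.
have /choice[opp oppE] : forall b, exists b', lab b' = ((lab b).2, (lab b).1).
  move=> b; have : (0 < M (lab b).1 (lab b).2)%N.
    by rewrite -labE; apply/card_gt0P; exists b; rewrite inE.
  move/Msym; rewrite -(labE ((lab b).2, (lab b).1)) => /card_gt0P[b'].
  by rewrite inE => /eqP; exists b'.
by exists (size ls), lab, opp.
Qed.

(** For a colour [i] other than that of the root, [tau i] is the colour of the parent of a vertex of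
    colour [i] of least depth, so the least depth of a colour drops along [tau]. *)
Lemma color_spanning_tree (V C : eqType) (E : V -> V -> Prop) r par
    (c : V -> C) : rooted E r par -> (forall i, exists x, c x = i) ->
  exists tau : C -> C,
    rooted (fun i j => (i <> c r /\ j = tau i) \/ (j <> c r /\ i = tau j)) (c r) tau /\
    forall i, i <> c r -> exists x y, [/\ E x y, c x = i & c y = tau i].
Proof.
move=> rE csurj; have [d [d0 dS]] := rooted_depth rE.
have /choice[x xP] : forall i, exists x, c x = i /\
    forall y, c y = i -> (d x <= d y)%N.
  move=> i; have ex : exists m, `[< exists x, c x = i /\ d x = m >].
    by have [x cx] := csurj i; exists (d x); apply/asboolP; exists x.
  case: (ex_minnP ex) => m /asboolP[x [cx dx]] mmin; exists x; split=> // y cy.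
  by rewrite dx; apply: mmin; apply/asboolP; exists y.
pose tau i := if i == c r then c r else c (par (x i)).
have xr i : i <> c r -> x i <> r by move=> ir xr; apply: ir; rewrite -xr (xP i).1.
exists tau; split; last first.
  move=> i ir; exists (x i), (par (x i)); split; last by rewrite /tau; case: eqP.
    exact/(rooted_par rE)/xr.
  exact: (xP i).1.
split; first by rewrite /tau eqxx.
split=> // i; elim: {i}(d (x i)).+1 {-2}i (ltnSn (d (x i))) => // m IH i im.
have [->|/eqP ir] := eqVneq i (c r); first by exists 0%N.
have [|q qP] := IH (tau i); last by exists q.+1; rewrite iterSr.
rewrite ltnS in im; apply: leq_trans im; rewrite (dS _ (xr _ ir)) ltnS.
by apply: (xP _).2; rewrite /tau; case: eqP.
Qed.

Lemma neighbour_counts (G : tgroup) k (V : pointedType) (E : V -> V -> Prop)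
    (a : G -> V -> V) (c : V -> 'I_k) :
  colored_action E a c -> (forall i, exists x, c x = i) ->
  exists N : 'I_k -> 'I_k -> nat, forall v j, exists l, [/\ uniq l,
    size l = N (c v) j & forall w, w \in l <-> E v w /\ c w = j].
Proof.
move=> [_ lf aut _ cE] /choice[x xP].
have /choice[l lP] : forall p : 'I_k * 'I_k, exists l, uniq l /\
    forall w, w \in l <-> E (x p.1) w /\ c w = p.2.
  move=> [i j]; have fin : finite_set [set w | E (x i) w /\ c w = j].
    by apply: sub_finite_set (lf (x i)) => w [].
  have [l lE] := (finite_seqP _).1 fin; exists (undup l).
  split=> [|w]; first exact: undup_uniq.
  rewrite mem_undup.
  by change ([set` l] w <-> [set w | E (x i) w /\ c w = j] w); rewrite lE.
exists (fun i j => size (l (i, j))) => v j.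
have [g gv] := (cE (x (c v)) v).1 (xP _); have [ul lE] := lP (c v, j).
have [h ha ah] := (aut g).1.
have cg w : c (a g w) = c w by apply/esym/cE; exists g.
exists (map (a g) (l (c v, j))); split.
- by rewrite (map_inj_uniq (can_inj ha)).
- by rewrite size_map.
move=> w; rewrite -(ah w) (mem_map (can_inj ha)) lE /= cg.
by rewrite -[X in E X (a g _)]gv (aut g).2.
Qed.

(** * Actions with the fewest orbits *)

Section MinimalAction.
Variables (G : tgroup) (k : nat) (V : pointedType) (E : V -> V -> Prop).
Variables (a : G -> V -> V) (c : V -> 'I_k.+1).
Hypotheses (Glc : is_lcgroup G) (ca : colored_action E a c).
Hypothesis min : ~ exists (W : pointedType) (F : W -> W -> Prop)
  (b : G -> W -> W) (d : W -> 'I_k), colored_action F b d.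

Lemma minimal_surj i : exists x, c x = i.
Proof.
apply: contrapT => nex; have [|d dE] := @drop_color _ _ c i.
  by move=> x cx; apply: nex; exists x.
apply: min; exists V, E, a, d; have [rE lf aut ga cE] := ca; split=> // x y.
by rewrite -cE !dE; split=> [->//|/lift_inj].
Qed.

(** The vertex [y] is one such neighbour; if it were the only one, the colour of [x] could be
    contracted. *)
Lemma minimal_count N :
  (forall v j, exists l, [/\ uniq l,
    size l = N (c v) j & forall w, w \in l <-> E v w /\ c w = j]) ->
  forall x y, E x y -> c x <> c y -> (2 <= N (c x) (c y))%N.
Proof.
move=> NP x y xy cxy; have [l [ul sl lE]] := NP x (c y).
have yl : y \in l by apply/lE.
rewrite leqNgt ltnS -sl; apply/negP => l1; apply: min.
apply: (contract_color Glc ca cxy) => v cv; have [l' [_ sl' l'E]] := NP v (c y).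
rewrite cv -sl in sl'; move: l1 sl' l'E yl.
case: l {ul sl lE} => // z [|//] _; case: l' => // w [|//] _ l'E _.
have /l'E[vw cw] : w \in [:: w] by rewrite inE.
exists w; split=> // u vu cu; apply/eqP.
by have /l'E := conj vu cu; rewrite inE.
Qed.

End MinimalAction.

(** * The group of label-preserving automorphisms *)

Section LabelledTree.
Variables (n : nat) (C : finType) (lab : 'I_n -> C * C).
Variable nb : Tn_vert n -> 'I_n -> Tn_vert n.
Hypothesis nb_inj : forall x, injective (nb x).
Hypothesis nbE : forall x y, Tn_adj x y <-> exists b, y = nb x b.
Hypothesis nbV : forall x b, exists b', nb (nb x b) b' = x /\
  lab b' = ((lab b).2, (lab b).1).

Definition labelled_adj (p : C * C) (x y : Tn_vert n) : Prop :=
  exists b, lab b = p /\ y = nb x b.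

Definition label_group := rel_aut_group labelled_adj.

Definition label_act (g : label_group) (x : Tn_vert n) : Tn_vert n :=
  (val (g : rel_aut labelled_adj) :
     {ptws Tn_vert n -> discrete_topology (Tn_vert n)}) x.

Lemma label_act_bij g : bijective (label_act g).
Proof. by have [] := set_valP (g : rel_aut labelled_adj). Qed.

Lemma label_actP g p x y :
  labelled_adj p (label_act g x) (label_act g y) <-> labelled_adj p x y.
Proof. by have [_] := set_valP (g : rel_aut labelled_adj); apply. Qed.

Lemma labelled_adjE x y : Tn_adj x y <-> exists p, labelled_adj p x y.
Proof.
by rewrite nbE; split=> [[b yb]|[p [b [_ yb]]]]; [exists (lab b), b|exists b].
Qed.

Lemma label_group_closed : closed_permutations (rel_aut labelled_adj).
Proof.
have [par rE] := Tn_rooted n.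
exact: (rel_aut_closed rE (@Tn_locally_finite n) labelled_adjE).
Qed.

(** All vertices have the same number of edges of each label, so the labelled trees rooted at
    [point] and at [x] are isomorphic. *)
Lemma label_transitive x : exists g, label_act g point = x.
Proof.
(* The label becomes a function of the endpoints of an edge, well defined as [nb] is injective;
   [option] supplies a value where there is no edge. *)
have /choice[lb lbP] : forall p : Tn_vert n * Tn_vert n, exists q,
    Tn_adj p.1 p.2 -> exists2 l, q = Some l & labelled_adj l p.1 p.2.
  move=> [y z]; have [/labelled_adjE[q qP]|ny] := pselect (Tn_adj y z).
    by exists (Some q) => _; exists q.
  by exists None.
have lbE p y z : labelled_adj p y z <-> Tn_adj y z /\ lb (y, z) = Some p.
  split=> [yzp|[/(lbP (y, z))[l -> yz] [<-]//]].
  have yz : Tn_adj y z by apply/labelled_adjE; exists p.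
  split=> //; have [l -> [b' /= [<- zb']]] := lbP (y, z) yz.
  have [b [<- zb]] := yzp; congr (Some (lab _)); apply: (@nb_inj y).
  by rewrite -zb'.
have adjV p y z : labelled_adj p y z -> labelled_adj (p.2, p.1) z y.
  by move=> [b [<- ->]]; have [b' [yb' lb']] := nbV y b; exists b'.
have [par rE] := Tn_rooted n; have [parx rx] := reroot x rE.
have [//|y z w u yw zu _ lyw|y z _ d|f [fb fp _ fE fl]] :=
  edge_colored_iso (k := fun=> tt) (k' := fun=> tt) (m := fun y z => lb (y, z))
    (m' := fun y z => lb (y, z)) rE rx.
- have [l lE yl] := lbP (y, w) yw; rewrite /= in yl.
  have zl : labelled_adj l z u by apply/lbE; rewrite -lyw lE.
  by have /lbE[_ ->] := adjV _ _ _ yl; have /lbE[_ ->] := adjV _ _ _ zl.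
- pose nbs t := if d is Some p then [seq nb t b | b <- enum [pred b | lab b == p]]
    else [::].
  have nbsE t w : w \in nbs t <-> Tn_adj t w /\ lb (t, w) = d.
    rewrite /nbs; case: (d) => [p|]; last first.
      by split=> // -[/(lbP (t, w))[l ->]].
    rewrite -lbE; split=> [/mapP[b]|[b [lbd ->]]].
      by rewrite mem_enum inE => /eqP lbd ->; exists b.
    by apply: map_f; rewrite mem_enum inE lbd.
  exists (nbs y), (nbs z); split=> //; rewrite /nbs; case: (d) => // p.
  + by rewrite map_inj_uniq // enum_uniq.
  + by rewrite map_inj_uniq // enum_uniq.
  + by rewrite !size_map.
have fS : rel_aut labelled_adj f.
  split=> // p y z; rewrite !lbE -fE.
  by split=> -[yz]; rewrite fl.
by exists (SigSub (mem_set fS)).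
Qed.

Lemma label_geometric : geometric label_act.
Proof.
split; first by [].
split; first by move=> g v; apply: perm_group_near.
split; first by move=> v w; exact: (perm_group_stab_compact label_group_closed).
exists [set point]; split; first exact: finite_set1.
by move=> x; have [g gx] := label_transitive x; exists g, point.
Qed.

Lemma label_to_AutTn : exists f : label_group -> AutTn n, copci f.
Proof.
have aS g : AutTn_set n (label_act g).
  split; first exact: label_act_bij.
  move=> x y; rewrite !labelled_adjE.
  by split=> -[p xy]; exists p; apply/(label_actP g).
exists (act_hom (@AutTn_comp n) aS).
apply: act_copci; first exact: AutTn_closed.
  exact/perm_group_lc/label_group_closed.
exact: label_geometric.
Qed.

Variables (V : pointedType) (E : V -> V -> Prop) (inC : C -> C -> Prop).
Variables (r : V) (par : V -> V).
Hypotheses (rE : rooted E r par) (lf : locally_finite_graph E).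
Variable f : Tn_vert n * C -> V.
Hypothesis fbij : bijective f.
Hypothesis fE : forall x y, blow_up nb lab inC x y <-> E (f x) (f y).

(** The group acts on the first coordinate of the blow-up and keeps the colour. Being transitive on
    the regular tree, it has at most one orbit per colour. *)
Lemma label_to_blow_up :
  exists h : label_group -> rel_aut_group (fun _ : unit => E), copci h.
Proof.
have [fV fK Kf] := fbij.
pose b (g : label_group) (v : V) := f (label_act g (fV v).1, (fV v).2).
have bf g x : b g (f x) = f (label_act g x.1, x.2) by rewrite /b fK.
have bbij g : bijective (b g).
  have [h gh hg] := label_act_bij g; exists (fun v => f (h (fV v).1, (fV v).2)).
    by move=> v; rewrite /b fK /= gh -surjective_pairing Kf.
  by move=> v; rewrite /b fK /= hg -surjective_pairing Kf.
have bE g v w : E (b g v) (b g w) <-> E v w.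
  rewrite -(Kf v) -(Kf w) !bf -!fE /blow_up /=.
  have ginj := bij_inj (label_act_bij g).
  have := label_actP g ((fV v).2, (fV w).2) (fV v).1 (fV w).1.
  rewrite /labelled_adj => <-.
  by split=> -[[e i]|]; [left; split=> //; apply: ginj|right|left; rewrite e|right].
have bS g : rel_aut (fun _ : unit => E) (b g) by split.
have gb : geometric b.
  have [lM [lN [lP _]]] := label_geometric.
  split; first by move=> g h; apply/funext => v; rewrite /= /b fK lM.
  split.
    move=> g v; apply: filterS (lN g (fV v).1) => h /= hv.
    by rewrite /b hv.
  split.
    move=> v w; have [e|ne] := pselect ((fV v).2 = (fV w).2).
      have := lP (fV v).1 (fV w).1; congr compact; rewrite predeqE => g /=.
      rewrite /b; split=> [->|<-]; last by rewrite fK.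
      by rewrite e -surjective_pairing Kf.
    rewrite (_ : [set g | _] = set0); first exact: compact0.
    rewrite predeqE => g; split=> //= bvw; apply: ne.
    by rewrite -bvw /b fK.
  exists ((fun i => f (point, i)) @` [set: C]); split.
    by apply: finite_image; apply: finite_finset.
  move=> v; have [g gv] := label_transitive (fV v).1.
  exists g, (f (point, (fV v).2)); split; first by exists (fV v).2.
  by rewrite bf /= gv -surjective_pairing Kf.
exists (act_hom (@rel_aut_comp V unit (fun=> E)) bS).
apply: act_copci => //.
  by apply: (rel_aut_closed rE lf) => x y; split=> [xy|[]//]; exists tt.
exact/perm_group_lc/label_group_closed.
Qed.

End LabelledTree.

(** A 2-regular tree is a line; with at most one neighbour per vertex, the tree consists of the root
    and its neighbours. *)
Lemma few_neighbours_elementary (G : tgroup) (V : pointedType)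
    (E : V -> V -> Prop) r par (a : G -> V -> V) m : rooted E r par ->
  locally_finite_graph E -> (forall g, tree_automorphism E (a g)) ->
  geometric a -> (m < 3)%N ->
  (forall v, exists l, [/\ uniq l, size l = m & forall w, w \in l <-> E v w]) ->
  ~ non_elementary G.
Proof.
move=> rE lf aut ga m3 lP; have [m2|m1] : m = 2 \/ (m <= 1)%N by lia.
  apply: (line_elementary rE aut ga) => v; have [l [ul sl lE]] := lP v.
  rewrite m2 in sl; case: l sl ul lE => [//|y [//|z [|//]]] _ /= /andP[+ _] lE.
  rewrite inE => /eqP yz; exists y, z; split=> //.
  - by apply/lE; rewrite mem_head.
  - by apply/lE; rewrite !inE eqxx orbT.
  - by move=> w /lE; rewrite !inE => /orP[/eqP->|/eqP->]; [left|right].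
apply: (finite_elementary ga).
apply: (@sub_finite_set _ _ ([set r] `|` [set w | E r w])); last first.
  by rewrite finite_setU; split; [apply: finite_set1|apply: lf].
move=> v _; have [->|/eqP vr] := eqVneq v r; first by left.
have [pr|/eqP pr] := eqVneq (par v) r.
  by right=> /=; rewrite -pr; apply/(rooted_sym rE)/(rooted_par rE).
have [l [ul sl lE]] := lP (par v).
have vl : v \in l by apply/lE/(rooted_sym rE)/(rooted_par rE).
have pl : par (par v) \in l by apply/lE/(rooted_par rE).
case: l {ul lE} sl vl pl m1 => [//|x [|y l]] <- //.
rewrite !inE => /eqP vx /eqP px.
by case: (par2_neq rE vr); rewrite px vx.
Qed.

(** * From a minimal action to the commation *)

Section Commation.
Variables (G : tgroup) (k : nat) (V : pointedType) (E : V -> V -> Prop).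
Variables (a : G -> V -> V) (c : V -> 'I_k.+1).
Hypotheses (Glc : is_lcgroup G) (Gne : non_elementary G).
Hypothesis ca : colored_action E a c.
Hypothesis min : ~ exists (W : pointedType) (F : W -> W -> Prop)
  (b : G -> W -> W) (d : W -> 'I_k), colored_action F b d.

Lemma minimal_commable : exists n : nat, (3 <= n)%N /\ commable G (AutTn n).
Proof.
have [[r [par rE]] lf aut ga cE] := ca.
have csurj := minimal_surj ca min.
have [N NP] := neighbour_counts ca csurj.
have Nge2 := minimal_count Glc ca min NP.
have [tau [rC tauE]] := color_spanning_tree rE csurj.
move: rC; set inC : 'I_k.+1 -> 'I_k.+1 -> Prop := (X in rooted X) => rC.
have inNeq i j : inC i j -> i <> j.
  by move=> ij e; move: ij; rewrite e; apply: (rooted_irrefl rC).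
have inN i j : inC i j -> (2 <= N i j)%N.
  move=> ij; have [x [y [xy cx cy]]] : exists x y, [/\ E x y, c x = i & c y = j].
    case: (ij) => [[ir ->]|[jr ->]]; first exact: tauE.
    have [x [y [xy cx cy]]] := tauE j jr.
    by exists y, x; split=> //; apply: (rooted_sym rE).
  by rewrite -cx -cy; apply: Nge2 => //; rewrite cx cy; apply: inNeq.
(* Each copy of the spanning tree already supplies one edge along [inC]; [M i j] is the number of
   neighbours left to be supplied by edges between copies. *)
pose M i j := (N i j - `[<inC i j>])%N.
(* Along [inC] the count stays positive because [N] is at least 2; elsewhere an edge of [E] from [i]
   to [j] is read backwards. *)
have Msym i j : (0 < M i j)%N -> (0 < M j i)%N.
  rewrite /M; case: (asboolP (inC j i)) => [/inN|ji]; first by lia.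
  case: asboolP => [/(rooted_sym rC)//|_]; rewrite !subn0 => Nij.
  have [x cx] := csurj i; have [l [_ sl lE]] := NP x j.
  move: Nij; rewrite -cx -sl; case: l lE {sl} => // y l lE _.
  have [xy cy] := (lE y).1 (mem_head _ _).
  have [l' [_ sl' l'E]] := NP y (c x); rewrite -cy -sl'.
  have /l'E : E y x /\ c x = c x by split=> //; apply: (rooted_sym rE).
  by case: (l').
have [n [lab [opp [labM oppE]]]] := letters Msym.
have [nb [nb_inj nbE nbV]] := Tn_labelled oppE.
have [parT rT] := Tn_rooted n.
have rT' : rooted (fun s t => exists b, t = nb s b) point parT.
  by case: rT => ? [? rT]; split=> //; split=> // x y; rewrite -nbE.
have [parB rB] := blow_up_rooted rT' nb_inj nbV rC.
(* The blow-up is compared with [E], edges being labelled by their end colours. A vertex of colour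
   [i] has one neighbour of colour [j] in its copy if [inC i j], and [M i j] through letters, in all
   [N i j]. *)
have [//|x v w u _ _ _ [cw cu]|x v xv [i j]|f [fbij _ _ fE _]] :=
  edge_colored_iso (k := snd) (k' := c) (m := fun x y => (x.2, y.2))
    (m' := fun v w => (c v, c w)) rB rE.
- by rewrite cw cu.
- have [ix|ix] := eqVneq i x.2; last first.
    exists [::], [::]; split=> // w; split=> // -[_ [/esym/eqP]];
      by rewrite -?xv (negPf ix).
  have [l [ul sl lE]] := NP v j.
  exists ((if `[<inC i j>] then [:: (x.1, j)] else [::]) ++
          [seq (nb x.1 b, j) | b <- enum [pred b | lab b == (i, j)]]), l.
  have irr b : nb x.1 b != x.1.
    apply/eqP => e; have : Tn_adj x.1 x.1 by apply/nbE; exists b.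
    exact: (rooted_irrefl rT).
  split=> //.
  + rewrite cat_uniq map_inj_uniq ?enum_uniq; last by move=> b b' [/nb_inj].
    case: asboolP => _ /=; rewrite andbT; last by apply/hasPn.
    apply/hasPn => _ /mapP[b _ ->].
    by rewrite in_cons in_nil orbF; apply/eqP => -[e]; move: (irr b);
      rewrite e eqxx.
  + rewrite size_cat size_map -cardE labM /= /M sl -xv -ix.
    by case: asboolP => [/inN|_] /=; lia.
  + move=> [t d]; rewrite mem_cat; split.
      move=> /orP[|/mapP[b]].
        case: asboolP => // ij; rewrite inE => /eqP[-> ->]; rewrite /= ix.
        by split=> //; left; rewrite -ix.
      rewrite mem_enum inE => /eqP lb [-> ->]; rewrite /= -ix; split=> //.
      by right; exists b; rewrite -ix.
    move=> [tB /= [xi dj]]; move: tB; rewrite dj => -[[/= xt ij]|[b /= [lb tb]]].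
      by rewrite -xi (asboolT ij) -xt mem_head.
    apply/orP; right; rewrite tb; apply: (map_f (fun b => (nb x.1 b, j))).
    by rewrite mem_enum inE lb xi.
  + move=> w; rewrite lE -xv -ix.
    by split=> [[vw ->]|[vw [->]]].
exists n; split; last first.
  exists (rel_aut_group (fun _ : unit => E)), (label_group lab nb).
  have cl1 : closed_permutations (rel_aut (fun _ : unit => E)).
    by apply: (rel_aut_closed rE lf) => x y; split=> [xy|[]//]; exists tt.
  have cl2 := label_group_closed lab nbE.
  split; first exact: perm_group_lc cl1.
  split; first exact: perm_group_lc cl2.
  split.
    have aS g : rel_aut (fun _ : unit => E) (a g).
      by have [ab aE] := aut g; split.
    exists (act_hom (@rel_aut_comp V unit (fun=> E)) aS).
    by apply: act_copci.
  split; last exact: (label_to_AutTn nb_inj nbE nbV).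
  exact: (label_to_blow_up nb_inj nbE nbV rE lf fbij fE).
rewrite leqNgt; apply/negP => n3.
(* With a single colour the tree is [n]-regular. Otherwise an edge of the spanning tree needs a
   letter in each direction, which forces exactly two letters. *)
have [[i ir]|nir] := pselect (exists i, i <> c r); last first.
  have cr i : i = c r by apply: contrapT => ir; apply: nir; exists i.
  have Nn : N (c r) (c r) = n.
    have := labM (c r, c r); rewrite /= /M; case: asboolP => [/inNeq//|_].
    rewrite subn0 => <-; rewrite -[RHS]card_ord; apply: eq_card => b.
    by rewrite !inE; case: (lab b) => i j; rewrite (cr i) (cr j) eqxx.
  apply: (few_neighbours_elementary rE lf aut ga n3 _ Gne) => v.
  have [l [ul sl lE]] := NP v (c r); exists l; split=> //.
    by rewrite sl (cr (c v)).
  by move=> w; rewrite lE; split=> [[]|]//; rewrite (cr (c w)).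
have inT : inC i (tau i) by left.
have inT' : inC (tau i) i by right.
have ti : tau i <> i by apply/nesym/inNeq.
have letter j : j <> c r -> exists b, lab b = (j, tau j).
  move=> jr; have inTj : inC j (tau j) by left.
  have /card_gt0P[b] : (0 < #|[pred b | lab b == (j, tau j)]|)%N.
    by rewrite labM /= /M (asboolT inTj); have := inN _ _ inTj; lia.
  by rewrite inE => /eqP; exists b.
have [b1 lb1] := letter i ir.
have [b2 lb2] : exists b, lab b = (tau i, i).
  have /card_gt0P[b] : (0 < #|[pred b | lab b == (tau i, i)]|)%N.
    by rewrite labM /= /M (asboolT inT'); have := inN _ _ inT'; lia.
  by rewrite inE => /eqP; exists b.
have b12 : b1 != b2.
  by apply/eqP => b12; move: lb1; rewrite b12 lb2 => -[].
have all b : b = b1 \/ b = b2.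
  move: b1 b2 b b12 n3 {lb1 lb2} => [x ?] [y ?] [z ?] /eqP xy n3.
  have {}xy : x <> y by move=> e; apply: xy; apply: val_inj.
  have [zx|zy] : z = x \/ z = y by lia.
    by left; apply: val_inj.
  by right; apply: val_inj.
(* Otherwise the letter from [tau i] to its own parent colour would be a third one. *)
have tr : tau i = c r.
  apply: contrapT => tr; have [b lb] := letter _ tr.
  case: (all b) lb => ->; rewrite ?lb1 ?lb2 => -[].
    by move/esym.
  by move/esym; apply: (par2_neq rC ir).
have cases j : j = i \/ j = tau i.
  have [->|/eqP jr] := eqVneq j (c r); first by right.
  have [b] := letter _ jr.
  by case: (all b) => ->; rewrite ?lb1 ?lb2 => -[-> _]; [left|right].
(* One letter and one edge inside the copy give 2 neighbours of the other colour, and no letter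
   joins a colour to itself: the tree is 2-regular. *)
have card1l p q b : lab b = (p, q) -> p <> q -> inC p q -> N p q = 2.
  move=> lb pq ipq; have := labM (p, q); rewrite /= /M (asboolT ipq).
  have /fintype.eq_card1-> : [pred b' | lab b' == (p, q)] =i pred1 b.
    move=> b'; rewrite !inE; apply/eqP/eqP => [lb'|->//].
    move: lb lb'; case: (all b) => ->; case: (all b') => -> //;
      by rewrite lb1 lb2 => <- -[e1 e2]; case: ti.
  by have := inN _ _ ipq; lia.
have card0l p : N p p = 0.
  have := labM (p, p); rewrite /= /M; case: asboolP => [/inNeq//|_].
  rewrite subn0 => <-; apply: fintype.eq_card0 => b; rewrite !inE; apply/eqP => lb.
  by case: (all b) lb => ->; rewrite ?lb1 ?lb2 => -[e1 e2]; apply: ti; congruence.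
apply: (few_neighbours_elementary rE lf aut ga (isT : (2 < 3)%N) _ Gne) => v.
have [q [qN qcover]] : exists q, N (c v) q = 2 /\ forall j, j = c v \/ j = q.
  have [cv|cv] := cases (c v).
    exists (tau i); rewrite cv; split=> //.
    by apply: (card1l _ _ b1) => //; apply: nesym.
  exists i; rewrite cv; split; first exact: (card1l _ _ b2).
  by move=> j; have [->|->] := cases j; [right|left].
have [l [ul sl lE]] := NP v q; exists l; split=> //; first by rewrite sl.
move=> w; rewrite lE; split=> [[]//|vw]; split=> //.
have [cw|//] := qcover (c w); have [l' [_ sl' l'E]] := NP v (c v).
have /l'E : E v w /\ c w = c v by [].
by rewrite card0l in sl'; case: (l') sl'.
Qed.

End Commation.

(** The number of colours is lowered as long as possible; it cannot reach 0, as [point] has a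
    colour. *)
Lemma in_class_T_colored (G : tgroup) : in_class_T G ->
  exists k (V : pointedType) (E : V -> V -> Prop) (a : G -> V -> V)
    (c : V -> 'I_k.+1), colored_action E a c /\
  ~ exists (W : pointedType) (F : W -> W -> Prop) (b : G -> W -> W)
      (d : W -> 'I_k), colored_action F b d.
Proof.
move=> [Glc [_ [V [E [a [tE [lf ga]]]]]]].
have [k [c ca]] := orbit_coloring Glc tE lf ga.
elim: k V E a c ca {tE lf ga} => [|k IH] V E a c ca; first by case: (c point).
have [[W [F [b [d db]]]]|nW] := pselect (exists (W : pointedType)
  (F : W -> W -> Prop) (b : G -> W -> W) (d : W -> 'I_k), colored_action F b d).
  exact: IH db.
by exists k, V, E, a, c.
Qed.

Theorem theorem5p2 :
  forall G : tgroup, in_class_T G ->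
  exists n : nat, (3 <= n)%N /\ commable G (AutTn n).
Proof.
move=> G GT; have [k [V [E [a [c [ca min]]]]]] := in_class_T_colored GT.
by case: GT => Glc [Gne _]; apply: minimal_commable ca min.
Qed.
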